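(* For any integers $n,m\ge 1$ and any alt $m$-Tamari lattice $L$ (with parameters $n,m$), the down-degree statistic $\operatorname{ddeg}$ is homomesic with respect to the action of rowmotion on $L$, with average $\frac{m(n-1)}{m+1}$. That is, for every orbit $O$ of $\operatorname{row}\colon L\to L$, $$\frac{1}{|O|}\sum_{x\in O}\operatorname{ddeg}(x)=\frac{m(n-1)}{m+1}.$$
   Context: All posets are finite. If a cyclic group acts on a finite set $X$, a statistic $f\colon X\to\mathbb{R}$ is homomesic if its average over every orbit is the same. The down-degree $\operatorname{ddeg}(x)$ of an element $x$ of a lattice $L$ is the number of elements of $L$ that $x$ covers. Alt $\nu$-Tamari lattices. Lattice paths use unit east steps $E$ and north steps $N$. Write $\nu=E^{\nu_0}NE^{\nu_1}N\cdots NE^{\nu_n}$, encoded as $(\nu_0,\dots,\nu_n)$. A $\nu$-Dyck path is a lattice path with the same endpoints as $\nu$ lying weakly above $\nu$. An increment vector with respect to $\nu$ is a sequence $\delta=(\delta_1,\dots,\delta_n)$ of nonnegative integers with $\delta_i\le\nu_i$ for all $i$. For a $\nu$-Dyck path $\mu$, the $\delta$-altitude of its lattice points is defined as follows: the starting point has altitude $0$, each east step decreases the altitude by $1$, and the $i$-th north step of $\mu$ increases it by $\delta_i$. For a valley $EN$ of $\mu$, let $p$ be the lattice point between these two steps, let $q$ be the next lattice point of $\mu$ after $p$ with the same $\delta$-altitude as $p$, and let $\mu[p,q]$ be the subpath from $p$ to $q$. The $\delta$-rotation of $\mu$ at this valley is the path $\mu'$ obtained from $\mu$ by exchanging $\mu[p,q]$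 with the east step immediately preceding it; write $\mu\lessdot_\delta\mu'$. The alt $\nu$-Tamari lattice $\operatorname{Tam}_{\nu}(\delta)$ is the set of $\nu$-Dyck paths ordered by the reflexive transitive closure of $\lessdot_\delta$; it is a semidistributive lattice whose cover relations are exactly the $\delta$-rotations. Alt $m$-Tamari lattices. For integers $n,m\ge 1$ put $(a,b)=(n,nm+1)$, and let $\nu$ be the lowest lattice path with north and east steps that connects the lower-left and upper-right corners of a rectangle of height $a$ and width $b$ and stays weakly above the diagonal line connecting these corners. The alt $m$-Tamari lattices (for $n,m$) are the lattices $\operatorname{Tam}_{\nu}(\delta)$ for this $\nu$ and any increment vector $\delta$ with respect to $\nu$. Rowmotion. A lattice $L$ is semidistributive if for all $x,y,z\in L$: $x\vee y=x\vee z$ implies $x\vee(y\wedge z)=x\vee y$, and $x\wedge y=x\wedge z$ implies $x\wedge(y\vee z)=x\wedge y$. In a semidistributive lattice $L$, for each cover relation $x\lessdot y$ the set $\{z\in L: z\vee x=y\}$ has a minimum element $j_{x,y}$, which is join-irreducible. Let $\mathcal D_L(x)=\{j_{w,x}:w\lessdot x\}$ and $\mathcal U_L(x)=\{j_{x,w}:x\lessdot w\}$. The maps $\mathcal D_L$ and $\mathcal U_L$ are injective and have the same image, so there is a unique bijection $\operatorname{row}\colon L\to L$ (rowmotion) with $\mathcal U_L(x)=\mathcal D_L(\operatorname{row}(x))$ for all $x\in L$. *)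

(* Defs.v *)
From HB Require Import structures.
From mathcomp Require Import all_boot all_order all_algebra all_fingroup.
From mathcomp Require Import zify.

Set Implicit Arguments.
Unset Strict Implicit.
Unset Printing Implicit Defensive.

Import Order.TTheory GRing.Theory Num.Theory.

(* A lattice path starting at the origin is the sequence of its steps, and its
   lattice points are indexed by 0, ..., size s: the k-th one is the endpoint
   of [take k s]. *)

Notation lpath := (seq bool).
Notation north := true.
Notation east := false.

Definition nb_north (s : lpath) : nat := count_mem north s.
Definition nb_east (s : lpath) : nat := count_mem east s.

Definition ends_at (b a : nat) (s : lpath) : bool :=
  (nb_east s == b) && (nb_north s == a).

(* On each antidiagonal x + y = k both paths have exactly one lattice point;
   the one of [mu] must not be lower. *)
Definition weakly_above (mu nu : lpath) : bool :=
  [forall k : 'I_(size nu).+1, nb_north (take k nu) <= nb_north (take k mu)].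

(* The diagonal joins (0, 0) to (b, a): a point (x, y) lies weakly above it
   iff a * x <= b * y. *)
Definition above_diagonal (b a : nat) (s : lpath) : bool :=
  [forall k : 'I_(size s).+1,
    a * nb_east (take k s) <= b * nb_north (take k s)].

Definition lowest_above_diagonal (b a : nat) (nu : lpath) : Prop :=
  [/\ ends_at b a nu, above_diagonal b a nu &
      forall mu : lpath, ends_at b a mu -> above_diagonal b a mu ->
        weakly_above mu nu].

(* The encoding (nu_0, ..., nu_n) of E^nu_0 N E^nu_1 N ... N E^nu_n. *)
Fixpoint east_runs (s : lpath) : seq nat :=
  match s with
  | [::] => [:: 0]
  | true :: s' => 0 :: east_runs s'
  | false :: s' => incr_nth (east_runs s') 0
  end.

Lemma east_runsK (s : lpath) :
  flatten [seq north :: nseq k east | k <- east_runs s] = north :: s.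
Proof.
elim: s => [|[] s IHs] //=; first by rewrite IHs.
by move: IHs; case: (east_runs s) => [|k r] //= [->].
Qed.

(* [delta] lists delta_1, ..., delta_n, so delta_i.+1 is [nth 0 delta i]. *)
Definition increment_vector (nu : lpath) (delta : seq nat) : bool :=
  (size delta == nb_north nu) &&
  [forall i : 'I_(nb_north nu),
    nth 0 delta i <= nth 0 (east_runs nu) i.+1].

Section Rotation.

Variable delta : seq nat.

(* The delta-altitude of the endpoint of [s]. *)
Definition altitude (s : lpath) : int :=
  ((\sum_(0 <= i < nb_north s) nth 0 delta i)%N%:Z - (nb_east s)%:Z)%R.

(* The p-th lattice point of [mu] lies between the two steps of a valley. *)
Definition valley (mu : lpath) (p : nat) : bool :=
  [&& 0 < p, p < size mu, nth north mu p.-1 == east &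
      nth east mu p == north].

Definition next_same_altitude (mu : lpath) (p q : nat) : bool :=
  [&& p < q, q <= size mu, altitude (take q mu) == altitude (take p mu) &
      [forall r : 'I_q,
        (p < r) ==> (altitude (take r mu) != altitude (take p mu))]].

Definition rotate_valley (mu : lpath) (p q : nat) : lpath :=
  take p.-1 mu ++ drop p (take q mu) ++ east :: drop q mu.

Definition rotation (mu mu' : lpath) : bool :=
  [exists p : 'I_(size mu), exists q : 'I_(size mu).+1,
    [&& valley mu p, next_same_altitude mu p q &
        mu' == rotate_valley mu p q]].

(* A rotation strictly increases the following weight, hence iterated
   rotations define an antisymmetric relation. *)
Fixpoint weight (s : lpath) : nat :=
  if s is b :: s' then b * size s' + weight s' else 0.

Lemma weight_cat (s t : lpath) :
  weight (s ++ t) = weight s + nb_north s * size t + weight t.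
Proof.
elim: s => [|b s IHs] //=; rewrite IHs size_cat /nb_north /= eqb_id.
by rewrite mulnDr mulnDl -!addnA; congr (_ + _); rewrite addnCA.
Qed.

Lemma rotation_weight (mu mu' : lpath) :
  rotation mu mu' -> weight mu < weight mu'.
Proof.
case/existsP=> [[p /= _]] /existsP[[q /= _]].
case/and3P=> /and4P[p0 pn pE pN] /and4P[pq qn _ _] /eqP->.
rewrite /rotate_valley.
have qE : drop p (take q mu) = north :: drop p.+1 (take q mu).
  rewrite (drop_nth east) ?size_takel //; congr (_ :: _).
  by rewrite nth_take //; apply/eqP.
have mE : mu = take p.-1 mu ++ east :: drop p (take q mu) ++ drop q mu.
  rewrite -{1}(cat_take_drop p.-1 mu); congr (_ ++ _).
  rewrite (drop_nth north) ?(leq_ltn_trans (leq_pred _)) // (eqP pE) prednK //.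
  congr (_ :: _); rewrite -{1}(cat_take_drop q mu) drop_cat size_takel //.
  by rewrite pq.
rewrite {1}mE; move: (drop p.+1 _) qE => Q ->.
rewrite !weight_cat /= !weight_cat /= !size_cat /= ?size_cat /= ?mul0n /nb_north.
rewrite /= ?size_cat; lia.
Qed.

End Rotation.

Definition nu_dyck (nu mu : lpath) : bool :=
  ends_at (nb_east nu) (nb_north nu) mu && weakly_above mu nu.

Definition altTamari (nu : lpath) (delta : seq nat) : Type :=
  {mu : (size nu).-tuple bool | nu_dyck nu mu}.

Fact altTamari_display : Order.disp_t. Proof. exact. Qed.

Section AltTamari.

Variables (nu : lpath) (delta : seq nat).

HB.instance Definition _ := Finite.copy (altTamari nu delta)
  {mu : (size nu).-tuple bool | nu_dyck nu mu}.

Definition dyck_path (x : altTamari nu delta) : lpath := val (sval x).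

Definition rotates (x y : altTamari nu delta) : bool :=
  rotation delta (dyck_path x) (dyck_path y).

(* [connect] is the reflexive transitive closure. *)
Definition altTamari_le : rel (altTamari nu delta) := connect rotates.

Lemma altTamari_le_weight (x y : altTamari nu delta) :
  altTamari_le x y ->
  (x == y) || (weight (dyck_path x) < weight (dyck_path y)).
Proof.
case/connectP=> s; elim: s x => [|z s IHs] x /=; first by move=> _ ->; rewrite eqxx.
case/andP=> /rotation_weight xz /IHs{}IHs /IHs /orP[/eqP <-|zy]; apply/orP; right=> //.
exact: ltn_trans zy.
Qed.

Lemma altTamari_le_anti : antisymmetric altTamari_le.
Proof.
move=> x y /andP[/altTamari_le_weight/orP[/eqP //|xy]].
by case/altTamari_le_weight/orP=> [/eqP //|/(ltn_trans xy)]; rewrite ltnn.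
Qed.

HB.instance Definition _ := Order.Le_isPOrder.Build altTamari_display
  (altTamari nu delta) (@connect0 _ rotates) altTamari_le_anti
  (fun y x z => @connect_trans _ rotates y x z).

End AltTamari.

(* Joins and minima are stated as relations on a finite poset, so that no proof
   that alt nu-Tamari posets are semidistributive lattices is needed here. *)
Section Rowmotion.

Local Open Scope order_scope.

Variables (d : Order.disp_t) (L : finPOrderType d).

Definition covers (x y : L) : bool :=
  (x < y) && [forall z, ~~ ((x < z) && (z < y))].

Definition ddeg (x : L) : nat := #|[set w | covers w x]|.

Definition is_join (x y z : L) : bool :=
  [&& x <= z, y <= z &
      [forall u, (x <= u) && (y <= u) ==> (z <= u)]].

(* [j] is j_{x,y}, the minimum of the set of all z with z \/ x = y. *)
Definition is_label (x y j : L) : bool :=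
  is_join j x y && [forall z, is_join z x y ==> (j <= z)].

Definition down_labels (x : L) : {set L} :=
  [set j | [exists w, covers w x && is_label w x j]].

Definition up_labels (x : L) : {set L} :=
  [set j | [exists w, covers x w && is_label x w j]].

Definition is_rowmotion (row : {perm L}) : Prop :=
  forall x, up_labels x = down_labels (row x).

End Rowmotion.

(* The cyclic group generated by [g] acts on [X]; its orbits are [porbits g]. *)
Definition homomesic_with_average (R : fieldType) (X : finType) (g : {perm X})
    (f : X -> R) (c : R) : Prop :=
  forall O : {set X}, O \in porbits g ->
    ((\sum_(x in O) f x) / #|O|%:R = c)%R.

(* Main.v *)
Require Import Defs.
From HB Require Import structures.
From mathcomp Require Import all_boot all_order all_algebra all_fingroup.
From mathcomp Require Import zify.

Set Implicit Arguments.
Unset Strict Implicit.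
Unset Printing Implicit Defensive.

Import Order.TTheory GRing.Theory Num.Theory.

(** A lattice path can be read as the history of a queue. At the i-th north step
nu_i customers arrive; delta_i of them go to the front of the queue, the other
nu_i - delta_i to its end. An east step serves the customer at the front. The
service time of a customer is the number of north steps before the east step
that serves it.

Lying weakly above nu means never to serve from an empty queue
([weakly_above_serviceable]), and a path is determined by its service times
([served_inj]). The delta-altitude varies like the number of customers who have
entered at the front, so the subpath moved by a delta-rotation starts and ends
with the same queue up to customers who entered at the end meanwhile: a rotation
postpones the service of a single customer and changes no other service time.
It follows that Tam_nu(delta) is the set of all possible service times with the
componentwise order ([altTamari_leE]). The possible ones are the schedules:
everybody is served after arriving, and before any customer of lower priority
who is still waiting then.

From there on, only schedules for a total priority order matter. An upper cover
of x postpones one customer o, the last one served at some time i, to the first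
time allowed ([covers_spec]). The label of this cover is the least schedule that
serves o after time i ([is_labelP]), and it determines o and i. So rowmotion
satisfies: x has an upper cover that postpones o from time i if and only if
row x has a lower cover that advances o to time i ([raised_row]).

Homomesy comes from counting service times. Fix a customer o that arrives at
time c < n and look at the queue from its front to o, right after that arrival.
Service times increase weakly along the queue. A service time greater than c is
recorded by the first customer having it, who can be advanced to a time at least
c; a service time different from that of o is recorded by the last customer
having it, who can be postponed. With time c, if somebody is served then, added to
the first list, and the service time of o added to the second one, the lists have
the same length ([balance]). In the sum over a rowmotion orbit, the customers in
front of o contribute the same to both sides, by the labels. What is left is
[orbit_balance]: the number of x in the orbit that serve somebody at time c, plus
the number of x that have a lower cover advancing o, is the size of the orbit.

Finally, let S be the sum of the down-degrees over the orbit O. Lower covers of x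
correspond to the customers that can be advanced; and x has one upper cover for
each time c < n at which somebody is served, while it has as many upper covers as
row x has lower covers. In the m-Tamari case, m customers arrive at each time c
with 0 < c < n, so the sum of [orbit_balance] over all of them reads
m S + S = m (n - 1) |O|. *)

#[local] Arguments nb_north : simpl never.
#[local] Arguments nb_east : simpl never.

(** * Extremal elements of a finite total order *)

Section Extremal.

Variables (B : finType) (r : rel B).
Hypotheses (r_irr : irreflexive r) (r_tr : transitive r).
Hypothesis r_tot : forall a b, a != b -> r a b || r b a.

Lemma ex_last (P : pred B) b : P b ->
  exists2 o, P o & forall a, P a -> ~~ r o a.
Proof.
move=> Pb; pose rank o := #|[set a | r a o]|.
case: (@arg_maxnP _ b P rank Pb) => o Po maxo; exists o => // a Pa.
apply/negP => oa; have := maxo a Pa; rewrite /= leqNgt => /negP; apply.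
apply: proper_card; apply/properP; split.
  by apply/subsetP => c; rewrite !inE => co; apply: r_tr oa.
by exists o; rewrite !inE ?r_irr ?oa.
Qed.

(** Each fibre of [f] on [S] has exactly one last element. The lemma is applied to
an order and to its converse. *)
Lemma card_last_of_fiber (K : finType) (f : B -> K) (S : {set B}) :
  #|[set o in S | [forall a in S, r o a ==> (f a != f o)]]| = #|f @: S|.
Proof.
set T := [set _ in _ | _].
have injf : {in T &, injective f}.
  move=> a b; rewrite !inE => /andP[aS /forall_inP la] /andP[bS /forall_inP lb] fab.
  apply/eqP/negPn/negP => /r_tot /orP[ab|ba].
    by have := la b bS; rewrite ab fab eqxx.
  by have := lb a aS; rewrite ba fab eqxx.
rewrite -(card_in_imset injf); apply: eq_card => k.
apply/imsetP/imsetP => -[o oS ->].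
  by exists o => //; move: oS; rewrite inE => /andP[].
have [] := @ex_last (fun a => (a \in S) && (f a == f o)) o; first by rewrite oS /=.
move=> a /andP[aS /eqP fa] la; exists a => //; rewrite inE aS.
apply/forall_inP => b bS; apply/implyP => ab; apply/eqP => fb.
by move: (la b); rewrite bS fb fa eqxx ab => /(_ isT).
Qed.

End Extremal.

(** * Schedules of a priority queue *)

Section Schedules.

Variables (B : finType) (arr : B -> nat) (prec : rel B) (N : nat).

(** Customer [o] arrives at time [arr o] and is served at time [g o]. If [prec a b],
then [a] has priority over [b], and must be served first once it has arrived. *)
Record schedule (g : B -> nat) : Prop := Schedule {
  schedule_ge : forall o, arr o <= g o;
  schedule_le : forall o, g o <= N;
  schedule_prec : forall a b, prec a b -> arr a <= g b -> g a <= g b }.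

Hypotheses (prec_irr : irreflexive prec) (prec_tr : transitive prec).
Hypothesis prec_tot : forall a b, a != b -> prec a b || prec b a.

Definition latest (g : B -> nat) (o : B) : bool :=
  (g o < N) && [forall a, prec o a ==> (g a != g o)].

Definition delay (g : B -> nat) (o : B) (k : nat) : B -> nat :=
  fun a => if a == o then k else g a.

(** A customer served at the same time as [o] but after it has lower priority, so in
[g] it cannot be served before [o] is. Hence, of the customers that [g] postpones,
the one of lowest priority is the last one served at its time in [f]. *)
Lemma latest_between f g b : schedule f -> schedule g ->
  (forall a, f a <= g a) -> f b < g b -> exists2 o, latest f o & f o < g o.
Proof.
move=> sf sg fg fgb.
have [o fgo lo] := @ex_last _ _ prec_irr prec_tr (fun o => f o < g o) _ fgb.
exists o => //; rewrite /latest (leq_trans fgo (schedule_le sg o)) /=.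
apply/forallP => a; apply/implyP => oa; apply/eqP => fa.
have := lo a; rewrite oa => /(_ _)/negP; apply => //.
rewrite fa; apply: leq_trans fgo _; apply: (schedule_prec sg oa).
by rewrite (leq_trans (schedule_ge sf o)) // -fa.
Qed.

(** The first time to which the last customer served at some time can be
postponed is the first later time at which all customers with priority over it
that have arrived are already served. A customer of lower priority served later
leaves [o] enough room: its own service time is such a time. *)
Lemma delay_latest g o : schedule g -> latest g o ->
  exists k, [/\ g o < k, schedule (delay g o k) &
    forall f, schedule f -> (forall a, g a <= f a) -> g o < f o -> k <= f o].
Proof.
move=> sg /andP[gN /forallP lo].
pose Q v := (g o < v) && [forall a, prec a o && (arr a <= v) ==> (g a <= v)].
have QN : exists v, Q v.
  exists N; rewrite /Q gN; apply/forallP => a; apply/implyP => _.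
  exact: schedule_le.
have [k /andP[gk /forallP ck] mink] := ex_minnP QN.
exists k; split=> //.
  split=> [a|a|a b]; rewrite /delay.
  - by case: eqP => [->|_]; rewrite ?(leq_trans (schedule_ge sg _)) // ltnW.
  - case: eqP => [_|_]; last exact: schedule_le.
    apply: mink; rewrite /Q gN; apply/forallP => c; apply/implyP => _.
    exact: schedule_le.
  - case: (eqVneq b o) => [-> ao|bo]; case: (eqVneq a o) => [->|nao] //.
    + by move=> ak; have := ck a; rewrite ao ak.
    + move=> ob ab; apply: mink; rewrite /Q ltn_neqAle.
      have := lo b; rewrite ob /= eq_sym => -> /=.
      rewrite (schedule_prec sg) //=; apply/forallP => c; apply/implyP => /andP[co cb].
      exact: (schedule_prec sg (prec_tr co ob) cb).
    + exact: (schedule_prec sg).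
move=> f sf gf gfo; apply: mink; rewrite /Q gfo; apply/forallP => a.
apply/implyP => /andP[ao af]; apply: leq_trans (gf a) _.
exact: (schedule_prec sf ao af).
Qed.

(** Serving everybody on arrival, except that [o] waits until [i] together with
those who are not allowed to overtake it. *)
Definition atom_schedule (o : B) (i : nat) : B -> nat :=
  fun a => if ((a == o) || prec o a) && (arr o <= arr a) then maxn (arr a) i
           else arr a.

Lemma atom_scheduleP o i : (forall a, arr a <= N) -> i <= N ->
  schedule (atom_schedule o i).
Proof.
move=> aN iN; split=> [a|a|a b ab]; rewrite /atom_schedule.
- by case: ifP => // _; rewrite leq_maxl.
- by case: ifP => // _; rewrite geq_max aN.
case: (boolP (((a == o) || prec o a) && _)) => [/andP[oa oaa]|//].
have -> : (b == o) || prec o b.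
  by case/orP: oa => [/eqP <-|/prec_tr->//]; rewrite ?ab orbT.
by case: ifP => /=; lia.
Qed.

Lemma atom_scheduleE o i : arr o <= i -> atom_schedule o i o = i.
Proof. by move=> oi; rewrite /atom_schedule eqxx leqnn /=; apply/maxn_idPr. Qed.

Lemma atom_schedule_min o i g : schedule g -> i <= g o ->
  forall a, atom_schedule o i a <= g a.
Proof.
move=> sg ig a; rewrite /atom_schedule.
case: ifP => [/andP[oa oaa]|_]; last exact: schedule_ge.
rewrite geq_max (schedule_ge sg) /= (leq_trans ig) //.
case/orP: oa => [/eqP -> //|oa]; apply: (schedule_prec sg oa).
exact: leq_trans oaa (schedule_ge sg a).
Qed.

(** [o] is the customer of highest priority that does not leave on arrival. *)
Lemma atom_schedule_inj o o' i i' : arr o < i -> arr o' < i' ->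
  atom_schedule o i =1 atom_schedule o' i' -> (o = o') /\ (i = i').
Proof.
have first p p' k k' : arr p < k -> atom_schedule p k =1 atom_schedule p' k' ->
    (p == p') || prec p' p.
  move=> pk /(_ p); rewrite (atom_scheduleE (ltnW pk)) /atom_schedule.
  by case: (_ || _) => //= kp; rewrite kp ltnn in pk.
move=> oi oi' E; have eo : o = o'.
  case/orP: (first _ _ _ _ oi E) => [/eqP//|o1].
  case/orP: (first _ _ _ _ oi' (fsym E)) => [/eqP//|o2].
  by have := prec_tr o1 o2; rewrite prec_irr.
split=> //; have := E o; rewrite eo !atom_scheduleE // ltnW //.
by rewrite -eo.
Qed.

End Schedules.

(** * Covers and labels in a poset of schedules *)

Lemma sum_porbit (T : finType) (s : {perm T}) (O : {set T}) (F : T -> nat) :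
  O \in porbits s -> \sum_(x in O) F (s x) = \sum_(x in O) F x.
Proof.
case/imsetP=> y _ ->; rewrite [RHS](reindex_inj (@perm_inj _ s)).
by apply: eq_bigl => x; rewrite porbit_sym -(porbit_perm s 1) expg1 porbit_sym.
Qed.

Section ScheduleLattice.

Variables (B : finType) (arr : B -> nat) (prec : rel B) (N : nat).
Hypotheses (prec_irr : irreflexive prec) (prec_tr : transitive prec).
Hypothesis prec_tot : forall a b, a != b -> prec a b || prec b a.
(* The arrival time first decreases and then increases along the priority order, so
   that who arrives later never enters the interior of the queue. *)
Hypothesis arr_unimodal : forall a b c,
  prec a b -> prec b c -> arr b <= maxn (arr a) (arr c).

Variables (disp : Order.disp_t) (L : finPOrderType disp) (h : L -> B -> nat).
Hypothesis le_h : forall x y : L, (x <= y)%O = [forall o, h x o <= h y o].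
Hypothesis h_schedule : forall x, schedule arr prec N (h x).
Hypothesis h_onto : forall g, schedule arr prec N g -> exists x, h x =1 g.

Lemma le_hP (x y : L) : reflect (forall o, h x o <= h y o) (x <= y)%O.
Proof. by rewrite le_h; apply: forallP. Qed.

Lemma h_inj x y : h x =1 h y -> x = y.
Proof.
by move=> E; apply: le_anti; apply/andP; split; apply/le_hP => o; rewrite E.
Qed.

Lemma lt_ex (x y : L) : (x < y)%O -> exists o, h x o < h y o.
Proof.
move=> xy; apply/existsP; apply: contraTT xy => /existsPn ge.
by apply/negP => /lt_geF/negP; apply; apply/le_hP => o; rewrite leqNgt.
Qed.

Lemma coversP (x y : L) : reflect
  ((x < y)%O /\ forall z, (x < z)%O -> (z <= y)%O -> z = y) (covers x y).
Proof.
apply: (iffP andP) => -[xy cov]; split=> //.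
  move=> z xz; rewrite le_eqVlt => /orP[/eqP//|zy].
  by have /forallP/(_ z) := cov; rewrite xz zy.
apply/forallP => z; apply/negP => /andP[xz zy].
by have := zy; rewrite (cov z xz (ltW zy)) ltxx.
Qed.

Lemma latest_cover x o : latest prec N (h x) o ->
  exists y, [/\ covers x y, h x o < h y o, forall a, a != o -> h y a = h x a &
    forall z, (x <= z)%O -> h x o < h z o -> (y <= z)%O].
Proof.
move=> lo; have [k [serviceable ksch kmin]] := delay_latest prec_tr (h_schedule x) lo.
have [y hy] := h_onto ksch; have yo : h y o = k by rewrite hy /delay eqxx.
have ya a : a != o -> h y a = h x a by rewrite hy /delay => /negPf->.
have ymin z : (x <= z)%O -> h x o < h z o -> (y <= z)%O.
  move=> /le_hP xz xzo; apply/le_hP => a; case: (eqVneq a o) => [->|/ya->//].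
  by rewrite yo kmin.
have xy : (x < y)%O.
  rewrite lt_def; apply/andP; split.
    by apply/eqP => yx; move: serviceable; rewrite -yo yx ltnn.
  by apply/le_hP => a; case: (eqVneq a o) => [->|/ya->//]; rewrite yo ltnW.
exists y; split; rewrite ?yo //; apply/coversP; split=> // z xz zy.
apply/eqP; rewrite eq_le zy ymin ?ltW //.
have [a ax] := lt_ex xz; case: (eqVneq a o) => [<-//|/ya ya'].
by move/le_hP/(_ a): zy; rewrite ya' leqNgt ax.
Qed.

(** Since some customer that is last in [x] can already be postponed below [y], a
cover postpones nobody else, and as little as possible. *)
Lemma covers_spec x y o : covers x y -> h x o < h y o ->
  [/\ latest prec N (h x) o, forall a, a != o -> h y a = h x a &
    forall z, (x <= z)%O -> h x o < h z o -> (y <= z)%O].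
Proof.
move=> /coversP[xy cov] xyo.
have [|p lp xyp] := latest_between prec_irr prec_tr (h_schedule x) (h_schedule y) _ xyo.
  by apply/le_hP/ltW.
have [z [/coversP[xz _] xzp zx zmin]] := latest_cover lp.
have zy : z = y by apply: cov => //; apply: zmin => //; apply: ltW.
rewrite {z}zy in xz xzp zx zmin.
by case: (eqVneq o p) xyo => [-> //|/zx->]; rewrite ltnn.
Qed.

Lemma covers_change x y : covers x y -> exists o, h x o < h y o.
Proof. by case/coversP=> /lt_ex. Qed.

Lemma covers_change_uniq x y o p : covers x y ->
  h x o < h y o -> h x p < h y p -> o = p.
Proof.
move=> cxy xyo xyp; have [_ yx _] := covers_spec cxy xyo.
by apply/eqP/negPn/negP; rewrite eq_sym => /yx yp; rewrite yp ltnn in xyp.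
Qed.

(** Two elements covered by [x] that advance the same customer are comparable. *)
Lemma down_cover_uniq x y z o : covers y x -> covers z x ->
  h y o < h x o -> h z o < h x o -> y = z.
Proof.
wlog yz : y z / h y o <= h z o.
  move=> H cyx czx yo zo; case/orP: (leq_total (h y o) (h z o)) => le.
    exact: H.
  by apply/esym/H.
move=> cyx czx yo zo.
have [_ yx _] := covers_spec cyx yo; have [_ zx _] := covers_spec czx zo.
have {}yz : (y <= z)%O.
  by apply/le_hP => a; case: (eqVneq a o) => [->//|ao]; rewrite -yx -?zx.
case/coversP: czx => zx' _; case/coversP: cyx => _ ycov.
apply/eqP/negPn/negP => ny; have := zx'.
by rewrite (ycov z _ (ltW zx')) ?ltxx // lt_neqAle ny.
Qed.

Lemma covers_atom x y o : covers x y -> h x o < h y o ->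
  exists a, h a =1 atom_schedule arr prec o (h x o).+1.
Proof.
move=> cxy xyo; have [/andP[xN _] _ _] := covers_spec cxy xyo.
apply/h_onto/atom_scheduleP => // a.
exact: leq_trans (schedule_ge (h_schedule x) a) (schedule_le (h_schedule x) a).
Qed.

(** For [z] below [y], not lying below [x] means serving [o] after time [h x o]; and
then [y] is the join of [x] and [z] by minimality of the postponement. The
schedules with the first property have a least element. *)
Lemma is_labelP x y o j : covers x y -> h x o < h y o ->
  is_label x y j <-> h j =1 atom_schedule arr prec o (h x o).+1.
Proof.
move=> cxy xyo; have [lo yx ymin] := covers_spec cxy xyo.
have /coversP[xy _] := cxy; have [a ha] := covers_atom cxy xyo.
have aE z : (a <= z)%O = (h x o < h z o).
  apply/le_hP/idP => [/(_ o)|xz b].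
    by rewrite ha atom_scheduleE // ltnW // ltnS (schedule_ge (h_schedule x)).
  by rewrite ha (atom_schedule_min (h_schedule z)).
have joinE z : is_join z x y = (z <= y)%O && (a <= z)%O.
  apply/and3P/andP => [[zy _ /forallP yu]|[zy az]].
    rewrite zy aE ltnNge; split=> //; apply/negP => zx.
    have := yu x; rewrite lexx andbT (lt_geF xy) implybF => /negP; apply.
    apply/le_hP => b; case: (eqVneq b o) => [->//|/yx<-].
    by move/le_hP: zy.
  split=> //; first exact: ltW.
  apply/forallP => u; apply/implyP => /andP[zu xu]; apply: ymin => //.
  by rewrite -aE (le_trans az).
have -> : is_label x y j = (j == a).
  rewrite /is_label joinE; apply/andP/eqP => [[/andP[jy aj] /forallP ja]|->].
    apply/eqP; rewrite eq_le aj andbT; have := ja a.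
    by rewrite joinE lexx andbT => /implyP; apply; apply: le_trans jy.
  rewrite lexx andbT; split; first by rewrite aE.
  by apply/forallP => z; apply/implyP; rewrite joinE => /andP[].
by split=> [/eqP->//|hj]; apply/eqP/h_inj => b; rewrite hj ha.
Qed.

Definition raised_from (x : L) (o : B) (c : nat) : bool :=
  latest prec N (h x) o && (c <= h x o).

Definition lowered_to (x : L) (o : B) (c : nat) : bool :=
  [exists w, [&& covers w x, h w o < h x o & c <= h w o]].

Lemma label_exists (x y : L) : covers x y -> exists j, is_label x y j.
Proof.
move=> cxy; have [o xyo] := covers_change cxy; have [a ha] := covers_atom cxy xyo.
by exists a; apply/(is_labelP _ cxy xyo).
Qed.

Lemma label_inj (x y x' y' j : L) o o' : covers x y -> covers x' y' ->
  h x o < h y o -> h x' o' < h y' o' ->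
  is_label x y j -> is_label x' y' j -> o = o' /\ h x o = h x' o'.
Proof.
move=> cxy cxy' xyo xyo' /(is_labelP _ cxy xyo) E /(is_labelP _ cxy' xyo') E'.
have [|||-> [->]//] := @atom_schedule_inj _ arr prec prec_irr prec_tr
  o o' (h x o).+1 (h x' o').+1.
- by rewrite ltnS (schedule_ge (h_schedule x)).
- by rewrite ltnS (schedule_ge (h_schedule x')).
- by move=> a; rewrite -E E'.
Qed.

(** A label determines the customer that is moved and the earlier of its two
service times. *)
Lemma raised_row (x y : L) o c : up_labels x = down_labels y ->
  raised_from x o c = lowered_to y o c.
Proof.
move=> E; apply/andP/existsP => [[lo co]|[w /and3P[cwy wyo cw]]].
  have [z [cxz xzo _ _]] := latest_cover lo; have [j jl] := label_exists cxz.
  have : j \in up_labels x by rewrite inE; apply/existsP; exists z; rewrite cxz.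
  rewrite E inE => /existsP[w /andP[cwy jl']]; have [p wyp] := covers_change cwy.
  have [eo eh] := label_inj cxz cwy xzo wyp jl jl'.
  by exists w; rewrite cwy eo wyp -eh co.
have [j jl] := label_exists cwy.
have : j \in down_labels y by rewrite inE; apply/existsP; exists w; rewrite cwy.
rewrite -E inE => /existsP[z /andP[cxz jl']]; have [p xzp] := covers_change cxz.
have [eo eh] := label_inj cwy cxz wyo xzp jl jl'.
by have [] := covers_spec cxz xzp; rewrite eo -eh.
Qed.

Lemma sum_bool_uniq (T : finType) (P : pred T) :
  (forall a b, P a -> P b -> a = b) -> \sum_a (P a : nat) = [exists a, P a].
Proof.
move=> U; case: existsP => [[a Pa]|nP].
  rewrite (bigD1 a) //= Pa big1 // => b ba; case Pb: (P b) => //.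
  by rewrite (U _ _ Pb Pa) eqxx in ba.
by rewrite big1 // => a _; case Pa: (P a) => //; case: nP; exists a.
Qed.

Lemma ddeg_sum_lowered (x : L) : ddeg x = \sum_o lowered_to x o 0.
Proof.
pose P w o := covers w x && (h w o < h x o).
transitivity (\sum_w \sum_o (P w o : nat)).
  rewrite /ddeg -sum1dep_card big_mkcond /=; apply: eq_bigr => w _.
  rewrite (sum_bool_uniq (P := P w)) => [|a b /andP[c wa] /andP[_ wb]]; last first.
    exact: covers_change_uniq c wa wb.
  case: ifP => cw; last first.
    by case: existsP => // -[o]; rewrite /P cw.
  case: existsP => // -[]; have [o wo] := covers_change cw.
  by exists o; rewrite /P cw.
rewrite exchange_big /=; apply: eq_bigr => o _.
rewrite (sum_bool_uniq (P := P^~ o)) => [|a b /andP[ca wa] /andP[cb wb]]; last first.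
  exact: down_cover_uniq ca cb wa wb.
by congr (nat_of_bool _); apply: eq_existsb => w; rewrite /P andbT.
Qed.
(** Everything between the new schedule and [x] differs from [x] at [o] only. *)
Lemma lowered_delay x o c v : c <= v < h x o ->
  schedule arr prec N (delay (h x) o v) -> lowered_to x o c.
Proof.
move=> /andP[cv vx] /h_onto[w0 hw0].
have w0o : h w0 o = v by rewrite hw0 /delay eqxx.
have w0a a : a != o -> h w0 a = h x a by rewrite hw0 /delay => /negPf->.
pose P w := (w < x)%O && (w0 <= w)%O.
have Pw0 : P w0.
  rewrite /P lexx andbT lt_neqAle; apply/andP; split.
    by apply/eqP => E; rewrite -E w0o ltnn in vx.
  by apply/le_hP => a; case: (eqVneq a o) => [->|/w0a->//]; rewrite w0o ltnW.
have [w /andP[wx w0w] wmax] := @ex_last _ <%O ltxx lt_trans P w0 Pw0.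
have cwx : covers w x.
  apply/coversP; split=> // z wz; rewrite le_eqVlt => /orP[/eqP//|zx].
  by have := wmax z; rewrite /P zx wz (le_trans w0w (ltW wz)) => /(_ isT).
apply/existsP; exists w; rewrite cwx (leq_trans cv) /=; last first.
  by rewrite -w0o; move/le_hP: w0w.
rewrite andbT; have [a wa] := covers_change cwx.
case: (eqVneq a o) => [<-//|/w0a E].
by have /le_hP/(_ a) := w0w; rewrite E leqNgt wa.
Qed.

(** * Counting service times *)

(** Both sides count the service times of the customers of [S], who form the queue
right after time [c] from its front to [o]. The left-hand side counts each
service time at the first customer of [S] having it, except that the time [c] is
counted by its first summand; the right-hand side counts it at the last customer
of [S], and the summand 1 stands for [o] itself. *)
Lemma balance x o (c := arr o) : c < N ->
  [exists a, h x a == c]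
    + \sum_(a | (arr a <= c) && ((a == o) || prec a o)) lowered_to x a c
  = 1 + \sum_(a | (arr a <= c) && prec a o) raised_from x a c.
Proof.
move=> cN; have sx := h_schedule x.
pose S := [set a | [&& arr a <= c, (a == o) || prec a o & c <= h x a]].
pose F := [set a in S | [forall b in S, prec b a ==> (h x b != h x a)]].
pose E := [set a in S | [forall b in S, prec a b ==> (h x b != h x a)]].
(* The two sets have as many elements as there are service times on S. *)
have FE : #|F| = #|E|.
  have hN a : h x a < N.+1 by rewrite ltnS (schedule_le sx).
  have f_eq a b : (Ordinal (hN b) != Ordinal (hN a)) = (h x b != h x a) by [].
  have prec_tot' a b : a != b -> prec b a || prec a b.
    by rewrite eq_sym; apply: prec_tot.
  have first := @card_last_of_fiber _ (fun a b => prec b a) prec_irr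
    (fun b a c' ab bc => prec_tr bc ab) prec_tot' _ (fun a => Ordinal (hN a)) S.
  have last := @card_last_of_fiber _ prec prec_irr prec_tr prec_tot _
    (fun a => Ordinal (hN a)) S.
  by rewrite /F /E; move: first last => /= -> ->.
have oS : o \in S by rewrite inE leqnn eqxx (schedule_ge sx).
have oE : o \in E.
  rewrite inE oS; apply/forall_inP => b; rewrite inE => /and3P[_ bo _].
  apply/implyP => ob; case/orP: bo => [/eqP bo|bo].
    by rewrite bo prec_irr in ob.
  by have := prec_tr ob bo; rewrite prec_irr.
have downE a : (arr a <= c) && ((a == o) || prec a o) ->
    lowered_to x a c = (a \in F) && (h x a != c).
  move=> /andP[ac ao]; apply/existsP/andP => [[w /and3P[cwx wa cw]]|[]].
    have [_ wx _] := covers_spec cwx wa.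
    rewrite inE inE ac ao (leq_trans cw (ltnW wa)) /=; split; last first.
      by rewrite neq_ltn (leq_ltn_trans cw wa) orbT.
    apply/forall_inP => b; rewrite inE => /and3P[bc _ _]; apply/implyP => ba.
    have nba : b != a by apply/eqP => ba'; rewrite ba' prec_irr in ba.
    rewrite (wx b nba) neq_ltn (leq_ltn_trans _ wa) //.
    by apply: (schedule_prec (h_schedule w) ba); apply: leq_trans cw.
  rewrite inE => /andP[aS /forall_inP aF] nac; apply/existsP.
  have cha : c < h x a.
    by rewrite ltn_neqAle eq_sym nac; move: aS; rewrite inE => /and3P[].
  have lower v : c <= v < h x a ->
      (forall b, prec b a -> arr b <= v -> h x b <= v) -> lowered_to x a c.
    move=> /[dup] cv /andP[cv' va] vP; apply: (lowered_delay cv); split=> [b|b|b1 b2].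
    - by rewrite /delay; case: eqP => [->|_]; rewrite ?(leq_trans ac) ?(schedule_ge sx).
    - rewrite /delay; case: eqP => _; rewrite ?(schedule_le sx) //.
      exact: leq_trans (ltnW va) (schedule_le sx a).
    - rewrite /delay; case: (eqVneq b2 a) => [->|n2]; case: (eqVneq b1 a) => [->|n1] //.
      + exact: vP.
      + move=> ab ab2; apply: leq_trans (ltnW va) _; exact: (schedule_prec sx).
      + exact: (schedule_prec sx).
  have trS b : prec b a -> arr b <= c -> b \notin S -> h x b < c.
    move=> ba bc; rewrite inE bc /= ltnNge; apply: contra => ->.
    rewrite andbT; case/orP: ao => [/eqP<-|ao]; first by rewrite ba orbT.
    by rewrite (prec_tr ba ao) orbT.
  (* a can move up to the service time of the customer b just in front of it, or
     to time c when it heads the queue. *)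
  case: (pickP (fun b => (b \in S) && prec b a)) => [b0 Pb0|nb].
    have [b /andP[bS ba] bmax] :=
      @ex_last _ prec prec_irr prec_tr (fun b => (b \in S) && prec b a) b0 Pb0.
    have [bc bo cb] : [/\ arr b <= c, (b == o) || prec b o & c <= h x b].
      by apply/and3P; move: bS; rewrite inE.
    apply: (lower (h x b)).
      rewrite cb ltn_neqAle (implyP (aF b bS)) //=.
      by rewrite (schedule_prec sx ba) // (leq_trans bc) // ltnW.
    move=> d da db; case: (eqVneq d b) => [->//|ndb].
    case/orP: (prec_tot ndb) => [db'|bd]; first exact: (schedule_prec sx db').
    have dc : arr d <= c.
      by apply: leq_trans (arr_unimodal bd da) _; rewrite geq_max bc ac.
    rewrite ltnW // (leq_trans (trS d da dc _) cb) //.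
    by apply/negP => dS; have := bmax d; rewrite dS da bd => /(_ isT).
  apply: (lower c); rewrite ?leqnn // => d da dc; rewrite ltnW // trS //.
  by apply/negP => dS; have := nb d; rewrite dS da.
have upE a : (arr a <= c) && prec a o -> raised_from x a c = (a \in E).
  move=> /andP[ac ao]; apply/andP/idP => [[/andP[_ /forallP la] ca]|].
    by rewrite !inE ac ao ca orbT; apply/forall_inP => b _; apply: la.
  rewrite inE => /andP[aS /forall_inP aE].
  have ca : c <= h x a by move: aS; rewrite inE => /and3P[].
  have ho : h x a < h x o.
    rewrite ltn_neqAle eq_sym (implyP (aE o oS)) //=.
    apply: (schedule_prec sx ao); exact: leq_trans ac (schedule_ge sx o).
  split=> //; apply/andP; split; first exact: leq_trans ho (schedule_le sx o).
  (* A customer b served with a and behind it would lie in S, or behind o, who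
     is served strictly later than a. *)
  apply/forallP => b; apply/implyP => ab; case: (eqVneq b o) => [->|nbo].
    by rewrite neq_ltn ho orbT.
  apply/eqP => hb; case/orP: (prec_tot nbo) => [bo|ob].
    have bS : b \in S.
      rewrite inE bo orbT hb ca !andbT; apply: leq_trans (arr_unimodal ab bo) _.
      by rewrite geq_max ac /=.
    by have := implyP (aE b bS) ab; rewrite hb eqxx.
  by have := schedule_prec sx ob; rewrite hb (leqNgt (h x o)) ho => /(_ ca).
have busyE : [exists a, h x a == c] = #|[set a in F | h x a == c]| :> nat.
  have -> : #|[set a in F | h x a == c]| = \sum_a ((a \in F) && (h x a == c) : nat).
    by rewrite -sum1dep_card big_mkcond /=; apply: eq_bigr => a _; case: ifP.
  rewrite (sum_bool_uniq (P := fun a => (a \in F) && (h x a == c))); last first.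
    move=> a b /andP[]; rewrite inE => /andP[aS /forall_inP aF] /eqP ha /andP[].
    rewrite inE => /andP[bS /forall_inP bF] /eqP hb.
    apply/eqP/negPn/negP => /prec_tot/orP[ab|ba].
      by have := implyP (bF a aS) ab; rewrite ha hb eqxx.
    by have := implyP (aF b bS) ba; rewrite ha hb eqxx.
  congr (nat_of_bool _).
  apply/existsP/existsP => [[a /eqP ha]|[a /andP[_ ha]]]; last by exists a.
  (* If the customer served at time c is behind o, then so is o served at c. *)
  have [b bS hb] : exists2 b, b \in S & h x b = c.
    have aS : prec a o -> a \in S.
      by move=> ao; rewrite inE ao orbT ha leqnn -{1}ha (schedule_ge sx).
    case: (eqVneq a o) => [ao|/prec_tot/orP[/aS|oa]].
    - by exists o => //; rewrite -ha ao.
    - by exists a.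
    - exists o => //; apply/eqP; rewrite eqn_leq (schedule_ge sx) andbT -ha.
      by apply: (schedule_prec sx oa); rewrite ha.
  have [] := @ex_last _ (fun a b => prec b a) prec_irr
    (fun b a c' ab bc => prec_tr bc ab) (fun b => (b \in S) && (h x b == c)) b.
    by rewrite bS hb /=.
  move=> d /andP[dS hd] dmin; exists d; rewrite hd andbT inE dS.
  apply/forall_inP => e eS; apply/implyP => ed; apply/eqP => he.
  by have := dmin e; rewrite eS he hd ed => /(_ isT).
have FT a : a \in F -> (arr a <= c) && ((a == o) || prec a o).
  by move=> /setIdP[+ _]; rewrite inE => /and3P[-> ->].
have ET a : a \in E -> a != o -> (arr a <= c) && prec a o.
  by move=> /setIdP[aS _] /negPf ao; move: aS; rewrite inE ao /= => /and3P[-> ->].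
clearbody F E.
have -> : \sum_(a | (arr a <= c) && ((a == o) || prec a o)) lowered_to x a c
   = #|[set a in F | h x a != c]|.
  rewrite -sum1dep_card big_mkcond [RHS]big_mkcond; apply: eq_bigr => a _.
  case: ifP => [/downE->|nT]; first by case: (_ && _).
  by case: ifP => // /andP[/FT]; rewrite nT.
have -> : \sum_(a | (arr a <= c) && prec a o) raised_from x a c = #|E :\ o|.
  rewrite -sum1_card big_mkcond [RHS]big_mkcond; apply: eq_bigr => a _.
  rewrite !in_setD1; case: ifP => [/[dup] /andP[_ ao] /upE->|nT].
    have -> : a != o by apply/eqP => ao'; rewrite ao' prec_irr in ao.
    by case: (a \in E).
  by case: ifP => // /andP[nao aE]; rewrite ET in nT.
rewrite busyE (cardsD1 o E) oE in FE *; rewrite -FE.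
rewrite -(cardsID [set a | h x a == c] F).
by congr (_ + _); apply: eq_card => a; rewrite !inE // andbC.
Qed.

(** Each time before [N] at which somebody is served has one last customer, and that
one can be postponed. *)
Lemma sum_raised x : \sum_o raised_from x o 0 = \sum_(c < N) [exists a, h x a == c].
Proof.
transitivity (\sum_o \sum_(c < N) (latest prec N (h x) o && (h x o == c) : nat)).
  apply: eq_bigr => o _.
  rewrite sum_bool_uniq => [|c d /andP[_ /eqP hc] /andP[_ /eqP hd]].
    congr (nat_of_bool _); rewrite /raised_from andbT.
    apply/idP/existsP => [lo|[c /andP[]//]].
    by have /andP[oN _] := lo; exists (Ordinal oN); rewrite lo /=.
  by apply: val_inj; rewrite /= -hc -hd.
rewrite exchange_big; apply: eq_bigr => c _.
rewrite sum_bool_uniq => [|a b /andP[/andP[_ /forallP la] /eqP ha]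
                              /andP[/andP[_ /forallP lb] /eqP hb]].
  congr (nat_of_bool _).
  apply/existsP/existsP => [[a /andP[_ ha]]|[a ha]]; first by exists a.
  have [b /eqP hb lb] := @ex_last _ _ prec_irr prec_tr (fun b => h x b == c) a ha.
  exists b; rewrite /latest hb eqxx ltn_ord andbT; apply/forallP => d.
  by apply/implyP => bd; apply/negP => /lb; rewrite bd.
apply/eqP/negPn/negP => /prec_tot/orP[ab|ba].
  by have := implyP (la b) ab; rewrite ha hb eqxx.
by have := implyP (lb a) ba; rewrite ha hb eqxx.
Qed.

Variable row : {perm L}.
Hypothesis rowP : is_rowmotion row.
Variable O : {set L}.
Hypothesis orbO : O \in porbits row.

Lemma sum_raised_lowered o c :
  \sum_(x in O) raised_from x o c = \sum_(x in O) lowered_to x o c.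
Proof.
rewrite -[RHS](sum_porbit _ orbO); apply: eq_bigr => x _.
by rewrite (raised_row _ _ (rowP x)).
Qed.

(** In the sum of [balance] over the orbit, the terms of the customers that precede
[o] cancel. *)
Lemma orbit_balance o : arr o < N ->
  \sum_(x in O) [exists a, h x a == arr o] + \sum_(x in O) lowered_to x o 0 = #|O|.
Proof.
move=> oN; set c := arr o.
have -> : \sum_(x in O) lowered_to x o 0 = \sum_(x in O) lowered_to x o c.
  apply: eq_bigr => x _; congr (nat_of_bool _); apply: eq_existsb => w.
  by rewrite (schedule_ge (h_schedule w)).
pose P a := (arr a <= c) && prec a o.
have : \sum_(x in O) ([exists a, h x a == c]
        + \sum_(a | (arr a <= c) && ((a == o) || prec a o)) lowered_to x a c)
     = \sum_(x in O) (1 + \sum_(a | P a) raised_from x a c).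
  by apply: eq_bigr => x _; exact: balance.
rewrite !big_split /= sum1_card.
rewrite [X in _ + X = _]exchange_big [X in _ = _ + X]exchange_big /=.
rewrite (bigD1 o) /= ?eqxx ?leqnn // addnA.
have -> : \sum_(a | (arr a <= c) && ((a == o) || prec a o) && (a != o))
             \sum_(x in O) lowered_to x a c
   = \sum_(a | P a) \sum_(x in O) raised_from x a c.
  apply: eq_big => [a|a _]; last by rewrite sum_raised_lowered.
  rewrite /P -andbA; congr (_ && _); case: (eqVneq a o) => [->|_] /=.
    by rewrite prec_irr.
  by rewrite andbT.
exact: addIn.
Qed.

Lemma sum_ddeg_service :
  \sum_(x in O) ddeg x = \sum_(c < N) \sum_(x in O) [exists a, h x a == c].
Proof.
rewrite exchange_big -(sum_porbit _ orbO); apply: eq_bigr => x _.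
rewrite -sum_raised ddeg_sum_lowered; apply: eq_bigr => o _.
by rewrite (raised_row _ _ (rowP x)).
Qed.

(** Customers arriving at time [N] are never moved, and nobody is served at time 0,
so both sums over customers reduce to [m] times a sum over times. *)
Lemma sum_ddeg_orbit m :
  (forall c, c < N -> #|[set o | arr o == c]| = if c == 0 then 0 else m) ->
  m.+1 * \sum_(x in O) ddeg x = m * N.-1 * #|O|.
Proof.
move=> cardB; pose b c := \sum_(x in O) [exists a, h x a == c].
have b0 : 0 < N -> b 0 = 0.
  move=> N0; apply: big1 => x _; case: existsP => // -[a /eqP ha].
  have /eqP := cardB 0 N0; rewrite cards_eq0 => /eqP/setP/(_ a).
  by rewrite !inE -leqn0 -ha (schedule_ge (h_schedule x)).
have sumB (F : nat -> nat) : (0 < N -> F 0 = 0) ->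
    \sum_(o | arr o < N) F (arr o) = m * \sum_(c < N) F c.
  move=> F0; rewrite big_distrr /=.
  transitivity (\sum_(o | arr o < N) \sum_(c < N) (if c == arr o :> nat then F c else 0)).
    apply: eq_bigr => o oN; rewrite (bigD1 (Ordinal oN)) //= eqxx big1 ?addn0 //.
    by move=> c nc; case: eqP => // co; case/eqP: nc; apply: val_inj.
  rewrite exchange_big; apply: eq_bigr => c _.
  have := cardB c (ltn_ord c); have := F0 (leq_ltn_trans (leq0n c) (ltn_ord c)).
  case: (val c =P 0) => [->|_].
    by move=> -> _; rewrite big1 ?muln0 // => o; case: ifP.
  move=> _ <-; rewrite -sum1dep_card big_distrl /= big_mkcond [RHS]big_mkcond.
  apply: eq_bigr => o _; rewrite mul1n eq_sym; case: eqP => [->|]; rewrite ?ltn_ord //.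
  by case: ifP.
have total : \sum_(o | arr o < N) \sum_(x in O) lowered_to x o 0 = \sum_(x in O) ddeg x.
  rewrite exchange_big; apply: eq_bigr => x _.
  rewrite ddeg_sum_lowered [RHS](bigID (fun o => arr o < N)) /=.
  rewrite [X in _ + X]big1 ?addn0 // => o; rewrite -leqNgt => No.
  apply/eqP; rewrite eqb0; apply/negP => /existsP[w /and3P[_ wx _]].
  have := leq_trans wx (schedule_le (h_schedule x) o).
  by rewrite ltnNge (leq_trans No) ?(schedule_ge (h_schedule w)).
have : \sum_(o | arr o < N) (b (arr o) + \sum_(x in O) lowered_to x o 0)
     = \sum_(o | arr o < N) #|O|.
  by apply: eq_bigr => o; apply: orbit_balance.
rewrite big_split total (sumB _ b0) /= -sum_ddeg_service -mulSnr => ->.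
pose F c := if c == 0 then 0 else #|O|.
rewrite -mulnA (_ : _ * #|O| = \sum_(c < N) F c) -?sumB //.
  apply: eq_bigr => o oN; rewrite /F; case: eqP => // o0.
  have := cardB _ oN; rewrite o0 eqxx => /eqP; rewrite cards_eq0 => /eqP/setP/(_ o).
  by rewrite !inE o0 eqxx.
case: N => [|k]; first by rewrite big_ord0.
rewrite big_ord_recl /F /= add0n (eq_bigr (fun=> #|O|)) // sum_nat_const card_ord.
by [].
Qed.

End ScheduleLattice.

(** * The queue driven by a lattice path *)

Lemma nb_north_cons b s : nb_north (b :: s) = b + nb_north s.
Proof. by rewrite /nb_north /= eqb_id. Qed.

Lemma nb_east_cons b s : nb_east (b :: s) = ~~ b + nb_east s.
Proof. by rewrite /nb_east /=; case: b. Qed.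

Lemma nb_north_cat s t : nb_north (s ++ t) = nb_north s + nb_north t.
Proof. exact: count_cat. Qed.

Lemma nb_east_cat s t : nb_east (s ++ t) = nb_east s + nb_east t.
Proof. exact: count_cat. Qed.

Lemma nb_steps s : nb_east s + nb_north s = size s.
Proof.
by elim: s => // b s; rewrite nb_north_cons nb_east_cons /= => <-; case: b => /=; lia.
Qed.

Fixpoint lookup (T : eqType) (b : T) (l : seq (T * nat)) (k : nat) : nat :=
  if l is p :: l' then if p.1 == b then p.2 else lookup b l' k else k.

Lemma lookup_cat (T : eqType) (b : T) l1 l2 k :
  lookup b (l1 ++ l2) k = lookup b l1 (lookup b l2 k).
Proof. by elim: l1 => //= p l1 ->. Qed.

Lemma lookup_mono (T : eqType) (b : T) l k k' : k <= k' -> lookup b l k <= lookup b l k'.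
Proof. by move=> kk; elim: l => //= p l IH; case: ifP. Qed.

Lemma lookup_bounds (T : eqType) (b : T) l k m M :
  all (fun p => m <= p.2 <= M) l -> m <= k <= M -> m <= lookup b l k <= M.
Proof. by elim: l => //= p l IH /andP[pm /IH{}IH] km; case: ifP => // _; apply: IH. Qed.

Section Queue.

(* v y customers arrive at height y, and d y of them enter at the front. *)
Variables v d : nat -> nat.
Hypothesis dv : forall y, d y <= v y.

(** The order in which two customers stand in the queue when both are waiting.
Customer (y, t) arrives at height y, and enters at the front when [t < d y]. *)
Definition prior (a b : nat * nat) : bool :=
  if a.2 < d a.1 then [|| d b.1 <= b.2, b.1 < a.1 | (a.1 == b.1) && (a.2 < b.2)]
  else (d b.1 <= b.2) && ((a.1 < b.1) || (a.1 == b.1) && (a.2 < b.2)).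

Lemma prior_irr : irreflexive prior.
Proof.
move=> a; rewrite /prior !ltnn eqxx /=.
by case: ltnP; rewrite ?andbF ?orbF // => /ltn_geF.
Qed.

Lemma prior_tr : transitive prior.
Proof.
move=> [b1 b2] [a1 a2] [c1 c2]; rewrite /prior /=.
case: (eqVneq a1 b1) => [->|ab]; case: (eqVneq b1 c1) => [->|bc];
  by rewrite ?eqxx ?(negPf ab) ?(negPf bc) /=; do 2 case: ifP; lia.
Qed.

Lemma prior_tot a b : a != b -> prior a b || prior b a.
Proof.
case: a b => a1 a2 [b1 b2]; rewrite /prior xpair_eqE /=.
case: (eqVneq a1 b1) => [->|ab] /=; rewrite ?eqxx.
  by do 2 case: ifP; lia.
by do 2 case: ifP; lia.
Qed.

Lemma prior_unimodal a b c : prior a b -> prior b c -> b.1 <= maxn a.1 c.1.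
Proof.
case: a b c => a1 a2 [b1 b2] [c1 c2]; rewrite /prior /=.
by do 2 case: ifP; lia.
Qed.

Definition dynamic y : seq (nat * nat) := [seq (y, t) | t <- iota 0 (d y)].
Definition static y : seq (nat * nat) := [seq (y, t) | t <- iota (d y) (v y - d y)].
Definition push y (st : seq (nat * nat)) := dynamic y ++ st ++ static y.

Lemma mem_dynamic y o : (o \in dynamic y) = (o.1 == y) && (o.2 < d y).
Proof.
case: o => o1 o2 /=; apply/mapP/andP => [[t]|[/eqP-> od]].
  by rewrite mem_iota => td [-> ->].
by exists o2; rewrite ?mem_iota.
Qed.

Lemma mem_static y o : (o \in static y) = (o.1 == y) && (d y <= o.2 < v y).
Proof.
case: o => o1 o2 /=; apply/mapP/andP => [[t]|[/eqP-> od]].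
  by rewrite mem_iota subnKC // => td [-> ->].
by exists o2; rewrite ?mem_iota ?subnKC.
Qed.

Lemma size_push y st : size (push y st) = size st + v y.
Proof. by rewrite !size_cat !size_map !size_iota; have := dv y; lia. Qed.

(** The invariant of a queue at height [y], listed from its front. *)
Definition queue y (st : seq (nat * nat)) : bool :=
  pairwise prior st && all (fun o => o.1 <= y) st.

Lemma queue_push y st : pairwise prior st -> all (fun o => o.1 < y) st ->
  queue y (push y st).
Proof.
move=> ps sy; apply/andP; split; last first.
  rewrite !all_cat; apply/and3P; split.
  - by apply/allP => o; rewrite mem_dynamic => /andP[/eqP->].
  - by apply: sub_all sy => o; apply: ltnW.
  - by apply/allP => o; rewrite mem_static => /andP[/eqP->].
have pw f m k : (forall t t', t < t' -> m <= t -> t' < m + k -> prior (f t) (f t')) ->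
    pairwise prior [seq f t | t <- iota m k].
  elim: k m => //= k IH m H; apply/andP; split.
    by apply/allP => o /mapP[t]; rewrite mem_iota => mt ->; apply: H; lia.
  by apply: IH => t t' tt' mt t'k; apply: H; lia.
rewrite /push !pairwise_cat ps !allrel_catr; apply/and5P; split.
- apply/andP; split; apply/allrelP => a b; rewrite mem_dynamic => /andP[/eqP a1 a2].
    by move=> /(allP sy) b1; rewrite /prior a1 a2 b1 !orbT.
  by rewrite mem_static => /andP[/eqP b1 /andP[b2 _]]; rewrite /prior a1 a2 b1 b2.
- by apply: pw => t t' tt' _ t'd; rewrite /prior /= eqxx tt' !orbT ifT // (ltn_trans tt').
- apply/allrelP => a b /(allP sy) a1; rewrite mem_static => /andP[/eqP b1 /andP[b2 _]].
  by rewrite /prior b1 b2 /= a1; case: ifP.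
- by [].
- by apply: pw => t t' tt' dt t'd; rewrite /prior /= eqxx tt' orbT andbT; case: ifP; lia.
Qed.

Lemma queue_north y st : queue y st -> queue y.+1 (push y.+1 st).
Proof. by case/andP=> ps sy; apply: queue_push. Qed.

Lemma queue_behead y o st : queue y (o :: st) -> queue y st.
Proof. by move=> /andP[/andP[_ p] /andP[_ q]]; apply/andP. Qed.

Lemma queue_head y o st a : queue y (o :: st) -> a \in st -> prior o a.
Proof. by move=> /andP[/andP[/allP p _] _] /p. Qed.

Lemma queue_uniq y st : queue y st -> uniq st.
Proof. by move=> /andP[p _]; apply: pairwise_uniq p; apply: prior_irr. Qed.

Lemma queue_arr y st o : queue y st -> o \in st -> o.1 <= y.
Proof. by move=> /andP[_ /allP]; apply. Qed.

Fixpoint log y (st : seq (nat * nat)) (s : seq bool) : seq (nat * nat * nat) :=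
  match s with
  | [::] => [::]
  | true :: s' => log y.+1 (push y.+1 st) s'
  | false :: s' => if st is o :: st' then (o, y) :: log y st' s' else log y st s'
  end.

Fixpoint after y (st : seq (nat * nat)) (s : seq bool) : seq (nat * nat) :=
  match s with
  | [::] => st
  | true :: s' => after y.+1 (push y.+1 st) s'
  | false :: s' => after y (behead st) s'
  end.

Definition served_at y st s o := lookup o (log y st s) (y + nb_north s).

Lemma served_north y st s o :
  served_at y st (true :: s) o = served_at y.+1 (push y.+1 st) s o.
Proof. by rewrite /served_at nb_north_cons /= add1n addnS. Qed.

Lemma served_east y o st s a :
  served_at y (o :: st) (false :: s) a = if o == a then y else served_at y st s a.
Proof. by rewrite /served_at nb_north_cons /= add0n. Qed.

Lemma served_east0 y s a : served_at y [::] (false :: s) a = served_at y [::] s a.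
Proof. by rewrite /served_at nb_north_cons /= add0n. Qed.

Lemma log_cat y st u s :
  log y st (u ++ s) = log y st u ++ log (y + nb_north u) (after y st u) s.
Proof.
elim: u y st => [|[] u IH] y st /=; first by rewrite addn0.
  by rewrite IH nb_north_cons addSnnS.
by rewrite nb_north_cons add0n; case: st => [|o st] /=; rewrite IH.
Qed.

Lemma served_cat y st u s o : served_at y st (u ++ s) o
  = lookup o (log y st u) (served_at (y + nb_north u) (after y st u) s o).
Proof. by rewrite /served_at log_cat lookup_cat nb_north_cat addnA. Qed.

Lemma after_queue y st u : queue y st -> queue (y + nb_north u) (after y st u).
Proof.
elim: u y st => [|[] u IH] y st qs /=; first by rewrite addn0.
  by rewrite nb_north_cons addnA addn1; apply/IH/queue_north.
rewrite nb_north_cons add0n; apply: IH.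
by case: st qs => //= o st /queue_behead.
Qed.

Lemma log_bounds y st s :
  all (fun p => y <= p.2 <= y + nb_north s) (log y st s).
Proof.
elim: s y st => [|[] s IH] y st //=; rewrite nb_north_cons.
  by apply: sub_all (IH _ _) => p; lia.
by case: st => [|o st] /=; rewrite add0n ?leqnn ?leq_addr IH.
Qed.

Lemma served_bounds y st s o : y <= served_at y st s o <= y + nb_north s.
Proof. by apply: lookup_bounds (log_bounds _ _ _) _; rewrite leqnn leq_addr. Qed.

(** Customers waiting at height [y] or arriving at a height in (y, k]. *)
Definition live y (st : seq (nat * nat)) k (o : nat * nat) : bool :=
  (o \in st) || [&& y < o.1, o.1 <= k & o.2 < v o.1].

Lemma live_push y st k o : y < k -> live y.+1 (push y.+1 st) k o = live y st k o.
Proof.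
move=> yk; rewrite /live !mem_cat mem_dynamic mem_static.
case: (o \in st); rewrite /= ?orbT //.
by have := dv o.1; case: (eqVneq o.1 y.+1) => [->|]; lia.
Qed.

Lemma live_east y o st k a : queue y (o :: st) ->
  live y st k a = live y (o :: st) k a && (a != o).
Proof.
move=> q; rewrite /live inE; case: (eqVneq a o) => [->|] /=; last by rewrite andbT.
have /= /andP[/negPf-> _] := queue_uniq q.
by rewrite ltnNge (queue_arr q (mem_head _ _)).
Qed.

(** Only the head of the queue is served, and the queue is sorted by priority. *)
Lemma served_valid y st s (k := y + nb_north s) : queue y st ->
  (forall o, live y st k o -> o.1 <= served_at y st s o) /\
  (forall a b, live y st k a -> live y st k b -> prior a b ->
     a.1 <= served_at y st s b -> served_at y st s a <= served_at y st s b).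
Proof.
rewrite {}/k; elim: s y st => [|[] s IH] y st q.
- split=> [o|//]; rewrite /served_at /= addn0 => /orP[/(queue_arr q)//|].
  by case/and3P.
- rewrite nb_north_cons addnA addn1.
  have [H1 H2] := IH _ _ (queue_north q).
  have E := @live_push y st (y.+1 + nb_north s) _ (leq_addr _ _).
  by split=> [o|a b]; rewrite -!E !served_north; [apply: H1|apply: H2].
- rewrite nb_north_cons add0n; case: st q => [|o st] q.
    have [H1 H2] := IH _ _ q.
    by split=> [o|a b]; rewrite !served_east0; [apply: H1|apply: H2].
  have [H1 H2] := IH _ _ (queue_behead q); have E := live_east _ _ q.
  have oy := queue_arr q (mem_head _ _).
  split=> [a la|a b la lb ab]; rewrite !served_east.
    by case: eqP => [<-//|/eqP ao]; apply: H1; rewrite E la eq_sym.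
  case: (eqVneq o b) => [ob|nb] /=; case: (eqVneq o a) => [oa|na] //.
  + move: la; rewrite /live inE eq_sym (negPf na) /= => /orP[ast _|]; last by lia.
    by rewrite -ob in ab; have := prior_tr ab (queue_head q ast); rewrite prior_irr.
  + by move=> _; case/andP: (served_bounds y st s b).
  + by apply: H2; rewrite ?E ?la ?lb // eq_sym.
Qed.

(** [s] never serves from an empty queue, if it starts at height [y] with [k]
waiting customers. *)
Fixpoint serviceable y k (s : seq bool) : bool :=
  if s is b :: s' then
    if b then serviceable y.+1 (k + v y.+1) s' else (0 < k) && serviceable y k.-1 s'
  else true.

Lemma serviceable_cat y st u s : serviceable y (size st) (u ++ s) ->
  serviceable (y + nb_north u) (size (after y st u)) s.
Proof.
elim: u y st => [|[] u IH] y st /=; first by rewrite addn0.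
  by rewrite nb_north_cons addnA addn1 -(size_push y.+1 st) => /IH.
rewrite nb_north_cons add0n => /andP[_]; rewrite -size_behead; exact: IH.
Qed.

(** At the first difference of the two paths, the customer at the head of the queue
is served at different times. *)
Lemma served_inj y st s s' : queue y st ->
  serviceable y (size st) s -> serviceable y (size st) s' ->
  size s = size s' -> nb_north s = nb_north s' ->
  (forall o, live y st (y + nb_north s) o ->
     served_at y st s o = served_at y st s' o) ->
  s = s'.
Proof.
have clash y0 st0 t t' : queue y0 st0 -> serviceable y0 (size st0) (false :: t) ->
    (forall o, o \in st0 ->
       served_at y0 st0 (false :: t) o = served_at y0 st0 (true :: t') o) -> False.
  case: st0 => [|o st0] q //= _ /(_ o (mem_head _ _)).
  rewrite served_east eqxx served_north => e.
  by have /andP[] := served_bounds y0.+1 (push y0.+1 (o :: st0)) t' o; rewrite -e ltnn.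
elim: s y st s' => [|b s IH] y st [|b' s'] // q.
case: b; case: b' => oks oks' /= [ss]; rewrite !nb_north_cons ?add0n.
- rewrite !add1n => -[nn] E; congr (_ :: _).
  apply: (IH _ _ _ (queue_north q)); rewrite ?size_push //.
  by move=> o; rewrite live_push ?leq_addr // addSnnS => /E; rewrite !served_north.
- move=> _ E; case: (clash _ _ s' s q oks') => o ost.
  by rewrite E // /live ost.
- move=> _ E; case: (clash _ _ s s' q oks) => o ost.
  by rewrite E // /live ost.
- case: st q oks oks' => //= o st q oks oks' nn E; congr (_ :: _).
  apply: (IH _ _ _ (queue_behead q) oks oks' ss nn) => a.
  rewrite (live_east _ _ q) => /andP[/E]; rewrite !served_east.
  by rewrite eq_sym; case: eqP.
Qed.
(** The path of a schedule serves the head of the queue as soon as its time has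
come. *)
Fixpoint build (g : nat * nat -> nat) k y st : seq bool :=
  if k is k'.+1 then
    if (if st is o :: _ then g o <= y else false) then false :: build g k' y (behead st)
    else true :: build g k' y.+1 (push y.+1 st)
  else [::].

Definition gain (f : nat -> nat) y m := \sum_(y <= i < y + m) f i.+1.

Lemma gain0 f y : gain f y 0 = 0.
Proof. by rewrite /gain addn0 big_geq. Qed.

Lemma gainS f y m : gain f y m.+1 = f y.+1 + gain f y.+1 m.
Proof. by rewrite /gain big_ltn ?addSnnS // addnS ltnS leq_addr. Qed.

Lemma gainD f y m k : gain f y (m + k) = gain f y m + gain f (y + m) k.
Proof. by rewrite /gain addnA -big_cat_nat ?leq_addr // -addnA leq_addr. Qed.

Lemma build_spec g n k y st (s := build g k y st) : queue y st -> y <= n ->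
  (forall o, live y st n o -> maxn y o.1 <= g o <= n) ->
  (forall a b, live y st n a -> live y st n b -> prior a b -> a.1 <= g b -> g a <= g b) ->
  k = size st + (n - y) + gain v y (n - y) ->
  [/\ size s = k, nb_north s = n - y, serviceable y (size st) s &
      forall o, live y st n o -> served_at y st s o = g o].
Proof.
rewrite {}/s; elim: k y st => [|k IH] y st q yn gb gp.
  move=> /esym/eqP; rewrite !addn_eq0 -andbA => /and3P[/nilP st0 /eqP ny _].
  rewrite st0 /= ny; split=> // o; rewrite /live /=.
  by move=> /and3P[yo on _]; have := leq_trans yo on; lia.
move=> kE /=; case: ifP => rdy.
  case: st q rdy gb gp kE => //= o st q oy gb gp [kE].
  have [|||s1 s2 s3 s4] := IH y st (queue_behead q) yn; rewrite ?kE //.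
  - by move=> a; rewrite (live_east _ _ q) => /andP[/gb].
  - by move=> a b; rewrite !(live_east _ _ q) => /andP[la _] /andP[lb _]; apply: gp.
  - rewrite -kE s1 nb_north_cons s2 s3; split=> // a la; rewrite served_east.
    case: (eqVneq o a) => [oa|oa]; last first.
      by apply: s4; rewrite (live_east _ _ q) la eq_sym.
    by apply/eqP; rewrite eqn_leq -{2}oa oy; have := gb _ la; lia.
(* At the last height everybody is due, so a north step is still to come. *)
have yn' : y < n.
  rewrite ltn_neqAle yn andbT; apply/eqP => yE; move: kE rdy.
  rewrite yE subnn gain0 !addn0; case: st q gb gp => //= o st q gb _ _.
  by have := gb o; rewrite /live mem_head => /(_ isT) /andP[_ ->].
have nyE : n - y = (n - y.+1).+1 by lia.
have [|||s1 s2 s3 s4] := IH y.+1 (push y.+1 st) (queue_north q) yn'.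
- move=> o; rewrite live_push // => lo; have /andP[go ->] := gb o lo; rewrite andbT.
  rewrite geq_max; move: go; rewrite geq_max => /andP[yg ->]; rewrite andbT.
  case/orP: (lo) => [|/and3P[yo _ _]]; last by have := gb o lo; lia.
  case: (st) q gp gb rdy => // a st' q gp gb /negbT.
  rewrite -ltnNge inE => ya /orP[/eqP->//|ost].
  apply: leq_trans ya _; apply: gp => //.
  - by rewrite /live mem_head.
  - by rewrite /live inE ost orbT.
  - exact: queue_head q ost.
  - exact: leq_trans (queue_arr q (mem_head _ _)) yg.
- by move=> a b; rewrite !live_push //; apply: gp.
- by move: kE; rewrite nyE gainS size_push; lia.
rewrite /= s1 nb_north_cons s2 nyE -size_push; split=> // o lo.
by rewrite served_north s4 // live_push.
Qed.

Lemma size_after_east y st u s : serviceable y (size st) (u ++ s) ->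
  size (after y st u) + nb_east u = size st + gain v y (nb_north u).
Proof.
elim: u y st => [|[] u IH] y st /=; first by rewrite gain0.
  rewrite -size_push => /IH; rewrite nb_north_cons nb_east_cons add1n gainS.
  by rewrite size_push /= add0n addnA.
by case: st => //= o st /IH; rewrite nb_north_cons nb_east_cons add0n /= addnCA => ->.
Qed.

Lemma serviceableP y k s : serviceable y k s <-> forall l, l <= size s ->
  nb_east (take l s) <= k + gain v y (nb_north (take l s)).
Proof.
elim: s y k => [|[] s IH] y k /=; split=> // H.
- case=> [_|l ls]; first by rewrite /= /nb_east.
  rewrite /= nb_east_cons nb_north_cons add0n add1n gainS addnA.
  by have/IH := H; apply.
- apply/IH => l ls; have := H l.+1 ls.
  by rewrite /= nb_east_cons nb_north_cons add0n add1n gainS addnA.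
- case=> [_|l ls]; first by rewrite /= /nb_east.
  case/andP: H => k0 /IH/(_ l ls).
  by rewrite /= nb_east_cons nb_north_cons add0n /=; lia.
- have k0 : 0 < k.
    have := H 1 isT; rewrite /= take0 nb_east_cons nb_north_cons /= gain0.
    by rewrite /nb_east /=; lia.
  rewrite k0; apply/IH => l ls; have := H l.+1 ls.
  by rewrite /= nb_east_cons nb_north_cons add0n /=; lia.
Qed.

(** The word [w] serves, for the first time at its end, a front part of [k]
customers together with all the customers that entered at the front meanwhile. *)
Fixpoint drains y k (w : seq bool) : bool :=
  if w is b :: w' then
    (0 < k) && if b then drains y.+1 (d y.+1 + k) w' else drains y k.-1 w'
  else k == 0.

Lemma drainsP y k w : drains y k w <->
  k + gain d y (nb_north w) = nb_east w /\
  forall l, l < size w ->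
    k + gain d y (nb_north (take l w)) <> nb_east (take l w).
Proof.
elim: w y k => [|b w IH] y k /=.
  by rewrite gain0 addn0 /nb_east; split=> [/eqP->|[->]].
rewrite nb_north_cons nb_east_cons; split=> [/andP[k0 H]|[H1 H2]].
  have {IH}/IH[H1 H2] : drains (y + b) ((if b then d y.+1 else 0) + k - ~~ b) w.
    by case: b H => /=; rewrite ?addn1 ?addn0 ?add0n ?subn0 ?subn1.
  split.
    by move: H1; case: b {H H2}; rewrite /= ?add1n ?gainS ?addn1 ?add0n ?addn0; lia.
  case=> [_|l /H2] /=; first by rewrite gain0 /nb_east /=; lia.
  rewrite nb_north_cons nb_east_cons; case: b {H H1 H2};
    rewrite /= ?add1n ?gainS ?addn1 ?add0n ?addn0; lia.
have k0 : 0 < k by have := H2 0 isT; rewrite /= gain0 /nb_east /=; lia.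
rewrite k0; case: b H1 H2 => /= H1 H2; apply/IH; split.
- by move: H1; rewrite add1n gainS; lia.
- move=> l lw; have := H2 l.+1 lw.
  by rewrite /= nb_north_cons nb_east_cons add1n gainS /=; lia.
- by move: H1; rewrite add0n; lia.
- move=> l lw; have := H2 l.+1 lw.
  by rewrite /= nb_north_cons nb_east_cons add0n /=; lia.
Qed.

Lemma drains_exists y k s : k + gain d y (nb_north s) <= nb_east s ->
  exists w r, s = w ++ r /\ drains y k w.
Proof.
elim: s y k => [|b s IH] y [|k].
- by exists [::], [::].
- by rewrite /nb_east /=; lia.
- by exists [::], (b :: s).
rewrite nb_north_cons nb_east_cons => H.
have [|w [r [-> dw]]] := IH (y + b) ((if b then d y.+1 else 0) + k.+1 - ~~ b).
  by case: b H; rewrite /= ?add1n ?gainS ?addn1 ?add0n ?addn0; lia.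
exists (b :: w), r; split=> //=.
by case: b dw {H}; rewrite /= ?addn1 ?addn0 ?add0n ?subn0 ?subn1.
Qed.

(** Such a word does not reach the rest [st] of the queue, whatever it is; it only
appends the customers [S] to it. *)
Lemma drains_frame y u w : drains y (size u) w -> exists S L,
  forall st, after y (u ++ st) w = st ++ S /\ log y (u ++ st) w = L.
Proof.
elim: w y u => [|[] w IH] y u /=.
- by move=> /nilP ->; exists [::], [::] => st; rewrite cats0.
- case/andP=> _; have -> : d y.+1 + size u = size (dynamic y.+1 ++ u).
    by rewrite size_cat size_map size_iota.
  move=> /IH[S [L H]]; exists (static y.+1 ++ S), L => st.
  by have := H (st ++ static y.+1); rewrite /push -!catA.
- case: u => // o u /= /IH[S [L H]]; exists S, ((o, y) :: L) => st.
  by have [-> ->] := H st.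
Qed.

Lemma drains_last y u back st w k : drains y (size u).+1 w -> back.1 <= y ->
  back \notin u -> lookup back (log y (rcons u back ++ st) w) k = y + nb_north w.
Proof.
elim: w y u st => [|[] w IH] y u st //=.
- rewrite addnS => dw backy nback; rewrite nb_north_cons add1n -addSnnS.
  have := IH y.+1 (dynamic y.+1 ++ u) (st ++ static y.+1).
  rewrite size_cat size_map size_iota rcons_cat /push -!catA; apply=> //; first exact: ltnW.
  by rewrite mem_cat mem_dynamic (negPf nback) orbF negb_and neq_ltn ltnS backy.
- rewrite nb_north_cons add0n; case: u => [|a u] /= dw backy nback; rewrite ?eqxx.
    by case: w dw {IH} => // _; rewrite addn0.
  by move: nback; rewrite inE negb_or eq_sym => /andP[/negPf-> nback]; apply: IH.
Qed.
Lemma after_cat y st u s :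
  after y st (u ++ s) = after (y + nb_north u) (after y st u) s.
Proof.
elim: u y st => [|[] u IH] y st /=; first by rewrite addn0.
  by rewrite IH nb_north_cons addnA addn1.
by rewrite IH nb_north_cons add0n.
Qed.

Lemma mem_after y st u o : o \in after y st u -> live y st (y + nb_north u) o.
Proof.
elim: u y st => [|[] u IH] y st /=; first by rewrite /live => ->.
  by move=> /IH; rewrite nb_north_cons addSnnS live_push // addnS ltnS leq_addr.
rewrite nb_north_cons add0n => /IH; case: st => //= a st.
by rewrite /live inE => /orP[->|->]; rewrite ?orbT.
Qed.

Lemma lookup_after y st u o k : queue y st -> o \in after y st u ->
  lookup o (log y st u) k = k.
Proof.
elim: u y st => [|[] u IH] y st q //=; first exact/IH/queue_north.
case: st q => [|a st] q /= oa; first exact: IH oa.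
rewrite (IH _ _ (queue_behead q) oa); case: eqP => // ao.
have := mem_after oa; rewrite /live -ao ltnNge (queue_arr q (mem_head _ _)) orbF => ast.
by have /= := queue_uniq q; rewrite ast.
Qed.

Lemma served_split y st s o : served_at y st s o < y + nb_north s ->
  exists u r st', [/\ s = u ++ false :: r, after y st u = o :: st' &
    served_at y st s o = y + nb_north u].
Proof.
elim: s y st => [|[] s IH] y st.
- by rewrite /served_at /= ltnn.
- rewrite served_north nb_north_cons addnA addn1 => /IH[u [r [st' [-> H1 H2]]]].
  by exists (true :: u), r, st'; rewrite H2 nb_north_cons addnA addn1.
- rewrite nb_north_cons add0n; case: st => [|a st]; rewrite ?served_east0 ?served_east.
    move=> /IH[u [r [st' [-> H1 H2]]]].
    by exists (false :: u), r, st'; rewrite H2 nb_north_cons add0n.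
  case: eqP => [-> _|_]; first by exists [::], s, st; rewrite addn0.
  move=> /IH[u [r [st' [-> H1 H2]]]].
  by exists (false :: u), r, st'; rewrite H2 nb_north_cons add0n.
Qed.

(** The subpaths moved by rotations: a north step followed by the service of all who
enter at the front from then on. *)
Definition excursion y (w : seq bool) : bool :=
  if w is true :: w' then drains y.+1 (d y.+1) w' else false.

Lemma excursion_frame y w : excursion y w -> exists S L,
  forall st, after y st w = st ++ S /\ log y st w = L.
Proof.
case: w => [|[] w] //=; have {1}-> : d y.+1 = size (dynamic y.+1).
  by rewrite size_map size_iota.
move=> /drains_frame[S [L H]]; exists (static y.+1 ++ S), L => st.
by have := H (st ++ static y.+1); rewrite -catA.
Qed.

(** The words on both sides serve the same customers at the same heights during the
excursion, which does not depend on the rest of the queue; and both leave the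
same queue. *)
Lemma served_rotate y o st w r a : excursion y w -> a != o ->
  served_at y (o :: st) (w ++ false :: r) a = served_at y (o :: st) (false :: w ++ r) a.
Proof.
move=> /excursion_frame[S [L H]] ao; rewrite served_east eq_sym (negPf ao) !served_cat.
have [-> ->] := H (o :: st); have [-> ->] := H st.
by rewrite served_east eq_sym (negPf ao).
Qed.

Lemma served_rotate_self y o st w r : excursion y w ->
  served_at y (o :: st) (w ++ false :: r) o <= y + nb_north w.
Proof.
move=> /excursion_frame[S [L H]]; rewrite served_cat.
have [-> _] := H (o :: st); rewrite served_east eqxx.
suff /andP[] : y <= lookup o (log y (o :: st) w) (y + nb_north w) <= y + nb_north w by [].
by apply: lookup_bounds (log_bounds _ _ _) _; rewrite leq_addr leqnn.
Qed.

Definition start := push 0 [::].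

Lemma queue_start : queue 0 start.
Proof. exact: queue_push. Qed.

Definition customer n (o : nat * nat) := (o.1 <= n) && (o.2 < v o.1).

Lemma live_start n o : live 0 start n o = customer n o.
Proof.
rewrite /live /start /push /customer mem_cat mem_dynamic mem_static.
case: (posnP o.1) => [->|o0]; last by [].
by rewrite orbF /=; case: ltnP => //= od; rewrite (leq_trans od).
Qed.

Lemma rotate_le u w r a : serviceable 0 (v 0) (u ++ false :: w ++ r) ->
  excursion (nb_north u) w ->
  served_at 0 start (u ++ false :: w ++ r) a
    <= served_at 0 start (u ++ w ++ false :: r) a.
Proof.
rewrite -[v 0]add0n -(size_push 0 [::]) => /serviceable_cat oku bw.
rewrite !(served_cat 0 start u) add0n.
apply: lookup_mono; case: (after _ _ _) oku => [//|o st _].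
case: (eqVneq a o) => [->|ao]; last by rewrite served_rotate.
rewrite served_east eqxx.
by case/andP: (served_bounds (nb_north u) (o :: st) (w ++ false :: r) o).
Qed.

(** [o] is the last customer served at height [y], so a north step follows; rotating
there postpones [o] to the end of the excursion [w]. This end is the service time
of [back], the last of the front customers arriving at [y.+1]. In [t], where [o]
is served after [y], the customer [back] has priority over [o], so [o] is served
not before the end of [w]. *)
Lemma rotation_between n s t o : serviceable 0 (v 0) s -> nb_north s = n ->
  nb_east s = v 0 + gain v 0 n -> nb_north t = n ->
  (forall a, customer n a -> served_at 0 start s a <= served_at 0 start t a) ->
  customer n o -> served_at 0 start s o < served_at 0 start t o ->
  (forall a, customer n a -> prior o a ->
     served_at 0 start s a != served_at 0 start s o) ->
  exists u w r, [/\ s = u ++ false :: w ++ r, excursion (nb_north u) w &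
    forall a, customer n a ->
      served_at 0 start (u ++ w ++ false :: r) a <= served_at 0 start t a].
Proof.
move=> oks sn se tn st bo so lo.
have sto : size start = v 0 by rewrite size_push.
have okS : serviceable 0 (size start) s by rewrite sto.
have tmax a : served_at 0 start t a <= n.
  by have := served_bounds 0 start t a; rewrite tn => /andP[_].
have [|u [s1 [st1 [sE au hu]]]] := @served_split 0 start s o.
  by rewrite sn; apply: leq_trans so (tmax o).
rewrite add0n in hu; set y := nb_north u in hu.
have qu : queue y (o :: st1).
  by have := after_queue u queue_start; rewrite au.
have oky : serviceable y (size st1) s1.
  by have := okS; rewrite sE => /serviceable_cat; rewrite au add0n /= .
have hcat a r : a \in o :: st1 ->
    served_at 0 start (u ++ r) a = served_at y (o :: st1) r a.
  by move=> ao; rewrite served_cat lookup_after ?au // queue_start.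
have yn : y < n by rewrite -hu (leq_trans so).
have nE : n = y + nb_north s1 by rewrite -sn sE nb_north_cat nb_north_cons.
(* Another east step would serve a customer of lower priority at the same height. *)
have [s2 s1E] : exists s2, s1 = true :: s2.
  case: s1 {nE} sE oky (nE) => [|[] s2] sE oky nE; first by rewrite nE addn0 ltnn in yn.
    by exists s2.
  case: st1 au qu hcat oky => [|a st1] au qu hcat //= _.
  have ao : prior o a by apply: queue_head qu _; rewrite mem_head.
  have ba : customer n a.
    rewrite -live_start; have := @mem_after 0 start u a.
    rewrite au !inE eqxx orbT => /(_ isT); rewrite /live => /orP[->//|/and3P[-> au' ->]].
    by rewrite (leq_trans au' (ltnW yn)) orbT.
  have := lo a ba ao; rewrite hu sE hcat ?inE ?eqxx ?orbT //.
  have oa : o != a by apply/eqP => E; rewrite E prior_irr in ao.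
  by rewrite !served_east (negPf oa) !eqxx.
rewrite {}s1E in sE oky nE.
(* All customers are served in the end, so the excursion does end. *)
have se2 : nb_east s2 = size st1 + gain v y (n - y).
  have := @size_after_east 0 start u (false :: true :: s2); rewrite sto -sE => /(_ oks).
  rewrite au /= => e1; have := se; rewrite sE nb_east_cat !nb_east_cons /=.
  have -> : n = y + (n - y) by lia.
  by move: e1; rewrite -/y gainD addKn !add0n; lia.
have [|w [r [s2E dw]]] := @drains_exists y.+1 (d y.+1) s2.
  have -> : d y.+1 + gain d y.+1 (nb_north s2) = gain d y (n - y).
    by rewrite -gainS; congr gain; rewrite nE nb_north_cons; lia.
  rewrite se2; apply: leq_trans (leq_addl _ _); apply: leq_sum => i _; exact: dv.
rewrite {}s2E in sE oky nE se2.
exists u, (true :: w), r; split=> // a ba.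
case: (eqVneq a o) => [->|ao]; last first.
  apply: leq_trans (st a ba); rewrite sE !(served_cat 0 start u) au add0n.
  by apply: lookup_mono; rewrite -cat_cons served_rotate.
have yo : y < served_at 0 start t o by rewrite -hu.
have oy : o.1 <= y := queue_arr qu (mem_head _ _).
rewrite served_cat lookup_after ?au ?mem_head ?queue_start // add0n.
apply: leq_trans (served_rotate_self _ _ _ _) _ => //.
(* Without front arrivals at y + 1, the excursion is a single north step. *)
rewrite -/y nb_north_cons; case dE: (d y.+1) dw => [|k] dw.
  by case: w {sE oky nE se2} dw => // _; rewrite addn0 addn1.
pose back := (y.+1, k).
have bback : customer n back by rewrite /customer /= yn (leq_trans _ (dv _)) // dE.
have pback : prior back o by rewrite /prior /= dE ltnS leqnn ltnS oy orbT.
have hback : served_at 0 start s back = y.+1 + nb_north w.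
  have dynE : dynamic y.+1 = rcons [seq (y.+1, t) | t <- iota 0 k] back.
    by rewrite /dynamic dE -[k.+1]addn1 iotaD map_cat cats1.
  have after2 : after 0 start (u ++ [:: false; true]) = push y.+1 st1.
    by rewrite after_cat au.
  have -> : s = (u ++ [:: false; true]) ++ w ++ r by rewrite sE -catA.
  rewrite served_cat lookup_after ?queue_start ?after2 //; last first.
    by rewrite /push dynE mem_cat mem_rcons mem_head.
  rewrite nb_north_cat !nb_north_cons -/y /= addn1 /served_at log_cat lookup_cat /push dynE.
  rewrite drains_last ?size_map ?size_iota //.
  by apply/mapP => -[i]; rewrite mem_iota => ik [e]; rewrite e ltnn andbF in ik.
rewrite add1n -addSnnS -hback; apply: leq_trans (st _ bback) _.
have [_ tv] := served_valid t queue_start; rewrite add0n tn in tv.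
by apply: tv; rewrite ?live_start.
Qed.

End Queue.

(** * Paths weakly above a given path *)

Lemma east_runs_cons s : exists k r, east_runs s = k :: r.
Proof.
elim: s => [|[] s [k [r IH]]] /=; first by exists 0, [::].
  by exists 0, (east_runs s).
by rewrite IH; exists k.+1, r.
Qed.

Lemma size_east_runs s : size (east_runs s) = (nb_north s).+1.
Proof.
elim: s => // b s; rewrite nb_north_cons /=.
by have [k [r ->]] := east_runs_cons s; case: b => /=; lia.
Qed.

Lemma sumn_east_runs s : sumn (east_runs s) = nb_east s.
Proof.
elim: s => // b s; rewrite nb_east_cons /=.
by have [k [r ->]] := east_runs_cons s; case: b => /=; lia.
Qed.

Lemma east_runs_take s l :
  nb_east (take l s) <= sumn (take (nb_north (take l s)).+1 (east_runs s)).
Proof.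
elim: s l => // b s IH [|l]; first by rewrite take0.
have := IH l; rewrite /= nb_east_cons nb_north_cons; case: b => //=.
by have [k [r ->]] := east_runs_cons s; rewrite add0n /=; lia.
Qed.

Lemma take_east_runs s l y : y < nb_north (take l s) ->
  sumn (take y.+1 (east_runs s)) <= nb_east (take l s).
Proof.
elim: s l y => // b s IH [|l] y //; rewrite /= nb_east_cons nb_north_cons.
case: b => /=.
  case: y => [|y] yl; first by rewrite take0.
  by rewrite !add0n; apply: IH.
by rewrite add0n => /IH; have [k [r ->]] := east_runs_cons s => /=; lia.
Qed.

Lemma gain_nth r y : nth 0 r 0 + gain (nth 0 r) 0 y = sumn (take y.+1 r).
Proof.
have -> : nth 0 r 0 + gain (nth 0 r) 0 y = \sum_(0 <= i < y.+1) nth 0 r i.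
  by rewrite /gain add0n [RHS]big_ltn // big_add1.
elim: r y => [|k r IH] y /=; first by rewrite big1 // => i _; rewrite nth_nil.
rewrite big_ltn //= big_add1 /=; case: y => [|y]; first by rewrite big_geq // take0.
by rewrite IH.
Qed.

(** At each antidiagonal, the path lies weakly above [nu] iff it has made at most the
east steps that [nu] makes up to the same height, that is, iff it has served no
more customers than have arrived. *)
Lemma weakly_above_serviceable nu mu (v := nth 0 (east_runs nu)) : size mu = size nu ->
  weakly_above mu nu = serviceable v 0 (v 0) mu.
Proof.
rewrite {}/v => sz; apply/forallP/idP => [ab|/serviceableP cap [l /= lnu]].
  apply/serviceableP => l lmu.
  have lnu : l < (size nu).+1 by rewrite -sz.
  have /= N_le := ab (Ordinal lnu).
  rewrite gain_nth; apply: leq_trans (_ : nb_east (take l nu) <= _).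
    have := nb_steps (take l nu); have := nb_steps (take l mu).
    by rewrite !size_takel -?sz //; lia.
  apply: leq_trans (east_runs_take _ _) _.
  rewrite -[X in _ <= sumn X](cat_take_drop (nb_north (take l nu)).+1) sumn_cat.
  by rewrite take_takel ?leq_addr.
rewrite leqNgt; apply/negP => lt; have := take_east_runs lt; rewrite -gain_nth.
have := cap l; rewrite sz -ltnS lnu => /(_ isT) capl le.
have := leq_trans capl le; move: lt.
have := nb_steps (take l nu); have := nb_steps (take l mu).
by rewrite !size_takel ?sz //; lia.
Qed.

(** * Rotations as postponements *)

Section Rotations.

Variable delta : seq nat.
Notation d := (nth 0 (0 :: delta)).

Lemma altitude_cat s t : (altitude delta (s ++ t) == altitude delta s)
  = (gain d (nb_north s) (nb_north t) == nb_east t).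
Proof.
rewrite /altitude nb_north_cat nb_east_cat (big_cat_nat (leq0n _) (leq_addr _ _)) /=.
by rewrite /gain /=; lia.
Qed.

(** During an excursion, the altitude relative to its starting point is the number of
its front customers not yet served. *)
Lemma next_same_altitude_excursion s w r :
  next_same_altitude delta (s ++ (true :: w) ++ r) (size s) (size s + (size w).+1)
  = excursion d (nb_north s) (true :: w).
Proof.
have alt l : l <= (size w).+1 ->
    (altitude delta (take (size s + l) (s ++ (true :: w) ++ r)) ==
     altitude delta (take (size s) (s ++ (true :: w) ++ r)))
    = (gain d (nb_north s) (nb_north (take l (true :: w)))
       == nb_east (take l (true :: w))).
  move=> lw; rewrite [take (size s) _]take_size_cat // take_cat ifN -?leqNgt ?leq_addr //.
  by rewrite addKn altitude_cat takel_cat.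
rewrite /next_same_altitude -{1}[size s]addn0 ltn_add2l alt //.
rewrite !size_cat leq_add2l /= leq_addr take_size.
set y := nb_north s; rewrite -[RHS]/(drains d y.+1 (d y.+1) w).
rewrite nb_north_cons nb_east_cons add1n add0n gainS andTb.
rewrite /= in alt; apply/andP/idP => [[/eqP E /forallP H]|/drainsP[E H]].
  apply/drainsP; split=> // l lw.
  have ltl : size s + l.+1 < size s + (size w).+1 by rewrite ltn_add2l.
  have sl : size s < size s + l.+1 by rewrite addnS ltnS leq_addr.
  have := implyP (H (Ordinal ltl)) sl; rewrite /= alt 1?ltnW //=.
  by rewrite nb_north_cons nb_east_cons add1n add0n gainS => /eqP.
split; first by apply/eqP.
apply/forallP => -[l /= lt]; apply/implyP => sl.
have lE : l = size s + (l - (size s).+1).+1 by lia.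
have lw : l - (size s).+1 < size w by lia.
rewrite lE alt 1?ltnW //= nb_north_cons nb_east_cons add1n add0n gainS.
by apply/eqP/H.
Qed.

Lemma rotationP mu mu' : reflect
  (exists u w r, [/\ mu = u ++ false :: w ++ r, excursion d (nb_north u) w &
                     mu' = u ++ w ++ false :: r])
  (rotation delta mu mu').
Proof.
apply: (iffP existsP) => [[[p /= pmu] /existsP[[q /= qmu]]]|].
  case/and3P=> /and4P[p0 _ pE pN] nx /eqP->.
  have /and4P[pq _ _ _] := nx.
  have qE : drop p (take q mu) = true :: drop p.+1 (take q mu).
    rewrite (drop_nth east) ?size_takel //; congr (_ :: _).
    by rewrite nth_take //; apply/eqP.
  have mE : mu = take p.-1 mu ++ false :: drop p (take q mu) ++ drop q mu.
    rewrite -{1}(cat_take_drop p.-1 mu); congr (_ ++ _).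
    rewrite (drop_nth true) ?(leq_ltn_trans (leq_pred _)) // (eqP pE) prednK //.
    congr (_ :: _); rewrite -{1}(cat_take_drop q mu) drop_cat size_takel //.
    by rewrite pq.
  exists (take p.-1 mu), (drop p (take q mu)), (drop q mu); split=> //.
  pose u := take p.-1 mu; pose w := drop p.+1 (take q mu).
  rewrite -/u qE -/w; have {}mE : mu = (u ++ [:: false]) ++ (true :: w) ++ drop q mu.
    by rewrite -catA {1}mE qE.
  have szu : size (u ++ [:: false]) = p.
    by rewrite size_cat size_takel ?addn1 ?prednK // (leq_trans (leq_pred _)) // ltnW.
  have szw : (size w).+1 = q - p.
    by have := congr1 size qE; rewrite size_drop size_takel.
  have := next_same_altitude_excursion (u ++ [:: false]) w (drop q mu).
  rewrite -mE szu szw subnKC ?nx; last exact: ltnW.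
  by rewrite nb_north_cat nb_north_cons addn0 => <-.
case=> u [[|[] w] [r [-> bw ->]]] //.
have sE : size (u ++ [:: false]) = (size u).+1 by rewrite size_cat addn1.
set mu0 := u ++ _.
have mE : mu0 = (u ++ [:: false]) ++ (true :: w) ++ r by rewrite -catA.
have szmu : size mu0 = (size u).+1 + (size w).+1 + size r.
  by rewrite mE size_cat sE size_cat /= addnA.
have szp : (size u).+1 < size mu0 by lia.
have szq : (size u).+1 + (size w).+1 < (size mu0).+1 by lia.
exists (Ordinal szp); apply/existsP; exists (Ordinal szq) => /=.
have -> : next_same_altitude delta mu0 (size u).+1 ((size u).+1 + (size w).+1).
  by rewrite mE -sE next_same_altitude_excursion nb_north_cat nb_north_cons addn0.
have -> : valley mu0 (size u).+1.
  by rewrite /valley szp /= !nth_cat ltnn subnn ltnNge leqnSn /= subSnn.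
rewrite /rotate_valley /=.
have -> : take (size u) mu0 = u by rewrite take_size_cat.
have qE : take ((size u).+1 + (size w).+1) mu0 = (u ++ [:: false]) ++ true :: w.
  by rewrite mE catA take_size_cat // size_cat sE.
have rE : drop ((size u).+1 + (size w).+1) mu0 = r.
  by rewrite mE (catA (u ++ _)) drop_size_cat // size_cat sE.
by rewrite qE rE drop_size_cat.
Qed.

End Rotations.

Lemma nb_north_take_rotate k u w r :
  nb_north (take k (u ++ false :: w ++ r)) <= nb_north (take k (u ++ w ++ false :: r)).
Proof.
elim: u k => [|b u IH] [|k] //=; last by rewrite !nb_north_cons leq_add2l.
rewrite nb_north_cons add0n.
elim: w k => [|b w IH] k /=; first by rewrite nb_north_cons.
by case: k => [|k]; rewrite ?take0 //= !nb_north_cons leq_add2l.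
Qed.

(** * The alt nu-Tamari poset as a poset of schedules *)

Section AltTamariSchedules.

Variables (nu : lpath) (delta : seq nat).
Hypothesis incr : increment_vector nu delta.

Notation n := (nb_north nu).
Notation v := (nth 0 (east_runs nu)).
Notation d := (nth 0 (0 :: delta)).
Notation L := (altTamari nu delta).

Lemma increment_le y : d y <= v y.
Proof.
case: y => [|y] //=; case/andP: incr => /eqP sd /forallP le.
case: (ltnP y n) => yn; first exact: (le (Ordinal yn)).
by rewrite nth_default // sd.
Qed.
Let dv := increment_le.

Definition customers : finType := {i : 'I_n.+1 & 'I_(v i)}.

Definition code (o : customers) : nat * nat := (tag o : nat, tagged o : nat).

Lemma code_inj : injective code.
Proof.
move=> [i t] [i' t'] [ii tt]; have {}ii : i = i' by apply: val_inj.
by subst i'; congr existT; apply: val_inj.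
Qed.

Lemma customer_code o : customer v n (code o).
Proof. by rewrite /customer -ltnS !ltn_ord. Qed.

Lemma codeP p : customer v n p -> exists o, code o = p.
Proof.
case: p => i t /andP[/= iN tv].
by exists (existT _ (Ordinal (iN : i < n.+1)) (Ordinal tv)).
Qed.

Definition service_time (x : L) (o : customers) : nat :=
  served_at v d 0 (start v d) (dyck_path x) (code o).

Let arr o := (code o).1.
Let prec o o' := prior d (code o) (code o').

Lemma size_dyck_path (x : L) : size (dyck_path x) = size nu.
Proof. by rewrite size_tuple. Qed.

Lemma dyck_pathP (x : L) :
  [/\ nb_east (dyck_path x) = nb_east nu, nb_north (dyck_path x) = n
    & serviceable v 0 (v 0) (dyck_path x)].
Proof.
have /andP[/andP[/eqP e /eqP f] ab] := svalP x.
by split=> //; rewrite -weakly_above_serviceable // size_dyck_path.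
Qed.

Lemma nb_east_gain : nb_east nu = v 0 + gain v 0 n.
Proof. by rewrite gain_nth -sumn_east_runs take_oversize // size_east_runs. Qed.

Lemma service_schedule x : schedule arr prec n (service_time x).
Proof.
have [_ nx _] := dyck_pathP x.
have [ge pr] := served_valid dv (dyck_path x) (queue_start dv).
rewrite add0n nx in ge pr.
split=> [o|o|a b ab].
- by apply: ge; rewrite live_start // customer_code.
- by have := served_bounds v d 0 (start v d) (dyck_path x) (code o); rewrite nx => /andP[].
- by apply: pr; rewrite ?live_start ?customer_code.
Qed.

Lemma service_onto g : schedule arr prec n g -> exists x, service_time x =1 g.
Proof.
move=> sg; pose g' p := if [pick o | code o == p] is Some o then g o else 0.
have g'E o : g' (code o) = g o.
  rewrite /g'; case: pickP => [o' /eqP/code_inj->//|/(_ o)].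
  by rewrite eqxx.
have [p|p q||] := @build_spec v d dv g' n (size nu) 0 (start v d)
  (queue_start dv) (leq0n n).
- rewrite live_start // => /codeP[o <-].
  by rewrite g'E max0n (schedule_ge sg) (schedule_le sg).
- rewrite !live_start // => /codeP[a <-] /codeP[b <-]; rewrite !g'E.
  exact: (schedule_prec sg).
- by rewrite size_push // add0n subn0 -nb_steps nb_east_gain addnAC.
set s := build _ _ _ _ _ _; rewrite subn0 size_push // add0n => szs ns oks hs.
have es : nb_east s = nb_east nu.
  by have := nb_steps s; have := nb_steps nu; lia.
have dy : nu_dyck nu s.
  by rewrite /nu_dyck /ends_at es ns !eqxx weakly_above_serviceable.
have szs' : size s == size nu by apply/eqP.
exists (exist _ (Tuple szs') dy : L) => o; rewrite /service_time -g'E; apply: hs.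
by rewrite live_start // customer_code.
Qed.

Lemma service_inj x y : service_time x =1 service_time y -> x = y.
Proof.
move=> E; have [ex nx okx] := dyck_pathP x; have [ey ny oky] := dyck_pathP y.
have : dyck_path x = dyck_path y.
  apply: (served_inj dv (queue_start dv)); rewrite ?size_push ?size_dyck_path ?nx ?ny //.
  by move=> p; rewrite live_start // => /codeP[o <-]; apply: E.
by move=> xy; apply/val_inj/val_inj.
Qed.

Lemma rotates_service x y o : rotates x y -> service_time x o <= service_time y o.
Proof.
case/rotationP=> u [w [r [xE bw yE]]]; have [_ _] := dyck_pathP x.
rewrite /service_time xE yE => okx; exact: rotate_le.
Qed.

Lemma prec_irr : irreflexive prec. Proof. by move=> o; apply: prior_irr. Qed.
Lemma prec_tr : transitive prec. Proof. by move=> a b c; apply: prior_tr. Qed.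
Lemma prec_tot a b : a != b -> prec a b || prec b a.
Proof. by move=> ab; apply: prior_tot; rewrite (inj_eq code_inj). Qed.

(** Postpone a customer that is last at its time and that [y] serves later. *)
Lemma rotates_between x y : x != y ->
  (forall o, service_time x o <= service_time y o) ->
  exists2 z, rotates x z & forall o, service_time z o <= service_time y o.
Proof.
move=> xy le; have [a lta] : exists a, service_time x a < service_time y a.
  apply/existsP; apply: contraNT xy => /existsPn ge; apply/eqP/service_inj => a.
  by apply/eqP; rewrite eqn_leq le leqNgt ge.
have [o /andP[_ /forallP lo] lto] :=
  latest_between prec_irr prec_tr (service_schedule x) (service_schedule y) le lta.
have [ex nx okx] := dyck_pathP x; have [ey ny oky] := dyck_pathP y.
have [|p|p|u [w [r [xE bw zy]]]] :=
  @rotation_between v d dv n (dyck_path x) (dyck_path y) (code o)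
    okx nx _ ny _ (customer_code o) lto.
- by rewrite ex nb_east_gain.
- by move=> /codeP[b <-]; apply: le.
- by move=> /codeP[b <-]; apply: (implyP (lo b)).
set s := u ++ w ++ false :: r in zy.
have szs : size s == size nu.
  by rewrite -(size_dyck_path x) xE /s !size_cat /= !size_cat /= addnS.
have es : nb_east s = nb_east nu.
  by rewrite -ex xE /s !nb_east_cat !nb_east_cons !nb_east_cat; lia.
have ns : nb_north s = n.
  by rewrite -nx xE /s !nb_north_cat !nb_north_cons !nb_north_cat; lia.
have dy : nu_dyck nu s.
  rewrite /nu_dyck /ends_at es ns !eqxx /=; apply/forallP => k.
  have /andP[_ /forallP/(_ k)] := svalP x; move/leq_trans; apply.
  by rewrite -/(dyck_path x) xE; apply: nb_north_take_rotate.
exists (exist _ (Tuple szs) dy : L); first by apply/rotationP; exists u, w, r.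
by move=> b; apply: zy; apply: customer_code.
Qed.

Lemma altTamari_leE x y :
  (x <= y)%O = [forall o, service_time x o <= service_time y o].
Proof.
apply/idP/forallP => [/connectP[p]|le].
  elim: p x => [|z p IH] x /=; first by move=> _ ->.
  move=> /andP[xz zp] /(IH _ zp) zy o.
  exact: leq_trans (rotates_service o xz) (zy o).
(* An element of greatest weight among those reachable from x and below y. *)
pose P z := connect (@rotates nu delta) x z
  && [forall o, service_time z o <= service_time y o].
have Px : P x by rewrite /P connect0; apply/forallP.
have [z /andP[xz /forallP zy] zmax] :=
  @arg_maxnP _ x P (fun z => weight (dyck_path z)) Px.
case: (eqVneq z y) => [<-//|/rotates_between/(_ zy)[t zt /forallP ty]].
have := zmax t; rewrite /P ty (connect_trans xz (connect1 zt)) => /(_ isT).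
by rewrite /= leqNgt (rotation_weight zt).
Qed.

Lemma card_customers c : c <= n -> #|[set o | arr o == c]| = v c.
Proof.
rewrite -ltnS => cn.
rewrite -sum1dep_card.
rewrite (eq_bigl (fun o : customers => (tag o == Ordinal cn) && true)) => [|o].
  rewrite -(sig_big_dep (fun i => i == Ordinal cn)
              (fun i (t : 'I_(v i)) => true) (fun _ _ => 1)) /=.
  by rewrite big_pred1_eq sum_nat_const card_ord muln1.
by rewrite andbT.
Qed.

Theorem altTamari_sum_ddeg m (row : {perm L}) (O : {set L}) :
  is_rowmotion row -> O \in porbits row ->
  (forall c, c < n -> v c = if c == 0 then 0 else m) ->
  m.+1 * \sum_(x in O) ddeg x = m * n.-1 * #|O|.
Proof.
move=> rowP orbO vE.
have arr_unimodal a b c : prec a b -> prec b c -> arr b <= maxn (arr a) (arr c).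
  exact: prior_unimodal.
apply: (sum_ddeg_orbit prec_irr prec_tr prec_tot arr_unimodal altTamari_leE
          service_schedule service_onto rowP orbO) => c cn.
by rewrite card_customers ?vE // ltnW.
Qed.

End AltTamariSchedules.

(** * Homomesy for alt m-Tamari lattices *)

Definition path_of_runs (r : seq nat) : lpath :=
  flatten [seq true :: nseq k false | k <- r].

Lemma east_runs_path_of_runs r : east_runs (path_of_runs r) = 0 :: r.
Proof.
elim: r => //= k r; rewrite -/(path_of_runs r); move: (path_of_runs r) => s E.
by congr (_ :: _); elim: k => //= k ->.
Qed.

Lemma weakly_above_anti mu nu : size mu = size nu ->
  weakly_above mu nu -> weakly_above nu mu -> mu = nu.
Proof.
move=> sz /forallP mn /forallP nm.
have {mn nm} : forall k, k <= size nu -> nb_north (take k mu) = nb_north (take k nu).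
  move=> k kn; have km : k < (size mu).+1 by rewrite sz.
  by apply/eqP; rewrite eqn_leq (mn (Ordinal (kn : k < (size nu).+1))) (nm (Ordinal km)).
elim: mu nu sz => [|a mu IH] [|b nu] //= [sz] E.
have ab : a = b.
  by have := E 1 isT; rewrite /= !take0 !nb_north_cons; case: (a) (b) => -[].
rewrite ab (IH nu sz) // => k kn; have := E k.+1 kn.
by rewrite /= !nb_north_cons ab => /addnI.
Qed.

(** The path with these runs lies above the diagonal, and the diagonal leaves room
for no more east steps at any height: at most [m * y] up to height [y <= n], and
one more than [n.+1 * m] at the top. *)
Lemma lowest_east_runs n m nu : lowest_above_diagonal (n.+1 * m + 1) n.+1 nu ->
  east_runs nu = 0 :: rcons (nseq n m) m.+1.
Proof.
move=> [/andP[/eqP eN /eqP nN] /forallP diag low].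
set r := rcons _ _; rewrite -(east_runs_path_of_runs r); set nu0 := path_of_runs r.
have rE : east_runs nu0 = 0 :: r := east_runs_path_of_runs r.
have n0 : nb_north nu0 = n.+1.
  by apply: succn_inj; rewrite -size_east_runs rE /= size_rcons size_nseq.
have e0 : nb_east nu0 = n.+1 * m + 1.
  by rewrite -sumn_east_runs rE /= /r -cats1 sumn_cat sumn_nseq /=; lia.
have sz : size nu = size nu0 by rewrite -!nb_steps eN nN n0 e0.
have cap y : y <= n.+1 -> sumn (take y.+1 (east_runs nu0))
    = if y == n.+1 then n.+1 * m + 1 else m * y.
  rewrite rE /= add0n /r -cats1 leq_eqVlt; case: eqP => [-> _|_ /= yn].
    by rewrite take_oversize ?size_cat ?size_nseq ?addn1 // sumn_cat sumn_nseq /=; lia.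
  by rewrite takel_cat ?size_nseq // take_nseq // sumn_nseq.
have le_take s k : nb_north (take k s) <= nb_north s.
  by rewrite -[X in _ <= nb_north X](cat_take_drop k) nb_north_cat leq_addr.
congr east_runs; apply: weakly_above_anti => //.
  rewrite weakly_above_serviceable //; apply/serviceableP => l lnu; rewrite gain_nth.
  have nl : nb_north (take l nu) <= n.+1 by rewrite -nN le_take.
  rewrite cap //; case: eqP => [_|/eqP ne].
    by rewrite -eN -[X in _ <= nb_east X](cat_take_drop l) nb_east_cat leq_addr.
  have ll : l < (size nu).+1 by [].
  have := diag (Ordinal ll); rewrite /=; move: nl ne; clear.
  set y := nb_north _; set x := nb_east _ => yn ny H.
  rewrite leqNgt; apply/negP => H'.
  have : n.+1 * (m * y).+1 <= n.+1 * x by rewrite leq_mul2l H' orbT.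
  by lia.
apply: low; first by rewrite /ends_at e0 n0 !eqxx.
apply/forallP => -[k /= _].
apply: leq_trans (_ : n.+1 * sumn (take (nb_north (take k nu0)).+1 (east_runs nu0)) <= _).
  by rewrite leq_mul2l east_runs_take orbT.
by rewrite cap -?n0 ?le_take // n0; case: eqP => [->|_]; lia.
Qed.

Theorem theorem5p2 (R : realFieldType) (n m : nat) (nu : seq bool)
    (delta : seq nat) (row : {perm altTamari nu delta}) :
  (0 < n)%N -> (0 < m)%N ->
  lowest_above_diagonal (n * m + 1) n nu ->
  increment_vector nu delta ->
  is_rowmotion row ->
  homomesic_with_average row (fun x => (ddeg x)%:R : R)%R
    (m%:R * (n%:R - 1) / (m%:R + 1))%R.
Proof.
case: n => // n _ _ low incr rowP O orbO.
have nN : nb_north nu = n.+1 by case: low => /andP[_ /eqP].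
have runs := lowest_east_runs low.
have := altTamari_sum_ddeg (m := m) incr rowP orbO _; rewrite nN => /(_ _)/= sumE.
have {}sumE : m.+1 * \sum_(x in O) ddeg x = m * n * #|O|.
  apply: sumE => -[|c] cn; rewrite runs //= nth_rcons nth_nseq size_nseq.
  by rewrite ltnS in cn; rewrite cn.
have O0 : 0 < #|O|.
  by case/imsetP: orbO => x _ ->; apply/card_gt0P; exists x; apply: porbit_id.
rewrite -natr_sum -[(n.+1%:R)%R]natr1 addrK [(m%:R + 1)%R]natr1 -natrM.
apply/eqP; rewrite eqr_div ?pnatr_eq0 -?lt0n // -!natrM eqr_nat.
by rewrite mulnC sumE.
Qed.
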